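(* Let $F_n$ denote the number of labelled $C_4$-free graphs on vertex set $[n]$, and let $$\gamma=\frac23\max_{x\in(0,1)}\frac{H(x^2)}{x}\approx 1.081919,$$ where $H(y)=-y\log_2 y-(1-y)\log_2(1-y)$ is the binary entropy function. Then there exists $\delta>0$ such that $$\log_2 F_n\le(1+o(1))(\gamma-\delta)n^{3/2}$$ as $n\to\infty$.
   Context: A graph is $C_4$-free if it contains no cycle of length $4$ as a subgraph. *)

(* Defs.v *)
From HB Require Import structures.
From mathcomp Require Import all_boot all_order all_algebra.
From mathcomp Require Import all_classical all_reals all_analysis.
From mathcomp Require Import ring lra.
Import Order.TTheory GRing.Theory Num.Theory.
Import numFieldNormedType.Exports.

Set Implicit Arguments.
Unset Strict Implicit.
Unset Printing Implicit Defensive.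

Local Open Scope classical_set_scope.
Local Open Scope ring_scope.

(* A graph with vertex type T is identified with its set of edges, an edge
   being an unordered pair of distinct vertices. *)
Definition is_graph (T : finType) (E : {set {set T}}) : bool :=
  [forall e in E, #|e| == 2%N].

Definition adj (T : finType) (E : {set {set T}}) : rel T :=
  fun x y => [set x; y]%SET \in E.

(* The subgraph need not be induced: chords of the 4-cycle are allowed. *)
Definition C4_free (T : finType) (E : {set {set T}}) : bool :=
  ~~ [exists c : 4.-tuple T, ucycleb (adj E) c].

Definition num_C4_free (n : nat) : nat :=
  #|[set E : {set {set 'I_n}} | is_graph E && C4_free E]%SET|.

Definition log2 (R : realType) (x : R) : R := ln x / ln 2.

Definition binary_entropy (R : realType) (y : R) : R :=
  - y * log2 y - (1 - y) * log2 (1 - y).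

(* The supremum is a maximum by [gamma_attained] and [gamma_ge]. *)
Definition gamma (R : realType) : R :=
  2 / 3 * sup [set binary_entropy (x ^+ 2) / x | x in [set x : R | 0 < x < 1]].

Section gamma_is_a_maximum.
Variable R : realType.
Implicit Types s x : R.

Let f x : R := binary_entropy (x ^+ 2) / x.

Let ln2_gt0 : 0 < ln (2 : R).
Proof. by rewrite ln_gt0// ltr1n. Qed.

Let fE x : 0 < x ->
  f x * ln 2 = - (x * ln (x ^+ 2)) - (1 - x ^+ 2) * ln (1 - x ^+ 2) / x.
Proof.
move=> x0; rewrite /f /binary_entropy /log2.
have l2 := lt0r_neq0 ln2_gt0.
have xn := lt0r_neq0 x0.
by rewrite expr2; field; rewrite l2 xn.
Qed.

Let ln_inv_le s : 0 < s -> - (s * ln s) <= 1 - s.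
Proof.
move=> s0.
have h : ln s^-1 <= s^-1 - 1.
  rewrite -[X in ln X](subrK 1) [X in ln X]addrC; apply: le_ln1Dx.
  by rewrite ltrBrDr addNr invr_gt0.
rewrite lnV ?posrE// in h.
have := ler_wpM2l (ltW s0) h.
by rewrite mulrN mulrBr mulr1 mulfV ?lt0r_neq0.
Qed.

Let ln_sq_le s : 0 < s -> - (s ^+ 2 * ln (s ^+ 2)) <= 2 * s.
Proof.
move=> s0; rewrite lnXn//.
have h := ln_inv_le s0.
have := ler_wpM2l (ltW s0) h.
rewrite mulr2n expr2; nra.
Qed.

Let sq_lt1 x : 0 < x < 1 -> 0 < 1 - x ^+ 2.
Proof. by move=> /andP[x0 x1]; rewrite expr2; nra. Qed.

Let f_near0 s : 0 < s <= 10^-1 -> f (s ^+ 2) * ln 2 <= 2^-1.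
Proof.
move=> /andP[s0 s1]; have x0 : 0 < s ^+ 2 by rewrite exprn_gt0.
have x1 : 0 < s ^+ 2 < 1 by rewrite x0 expr2; nra.
have h1 := ln_sq_le s0.
have h2 := ln_inv_le (sq_lt1 x1).
rewrite fE// lnXn//.
have h3 : - ((1 - (s ^+ 2) ^+ 2) * ln (1 - (s ^+ 2) ^+ 2)) / s ^+ 2 <= s ^+ 2.
  rewrite ler_pdivrMr//; apply: le_trans h2 _.
  by rewrite opprB addrC subrK.
rewrite mulNr in h3.
rewrite mulr2n; nra.
Qed.

Let f_near1 x : 1 - 1000^-1 <= x < 1 -> f x * ln 2 <= 2^-1.
Proof.
move=> /andP[xl xu]; have x0 : 0 < x by lra.
have x1 : 0 < x < 1 by rewrite x0.
have z0 := sq_lt1 x1.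
set s := Num.sqrt (1 - x ^+ 2).
have s0 : 0 < s by rewrite sqrtr_gt0.
have sE : s ^+ 2 = 1 - x ^+ 2 by rewrite sqr_sqrtr// ltW.
have s1 : s <= 10^-1.
  rewrite leNgt; apply/negP => s1.
  by move: sE; rewrite !expr2; nra.
have h1 := ln_inv_le x0.
have h2 := ln_sq_le s0.
rewrite fE// lnXn// -sE.
have h3 : - (s ^+ 2 * ln (s ^+ 2)) / x <= 3^-1.
  by rewrite ler_pdivrMr//; apply: le_trans h2 _; nra.
rewrite mulNr in h3.
rewrite mulr2n; nra.
Qed.

Let f_half : 2^-1 <= f 2^-1 * ln 2.
Proof.
have h0 : 0 < (2^-1 : R) by lra.
rewrite fE// lnXn//.
have h1 : ln (2^-1 : R) <= - 2^-1.
  have := @le_ln1Dx R (- 2^-1).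
  have -> : 1 + - 2^-1 = 2^-1 :> R by lra.
  by apply; lra.
have h2 : ln (1 - 2^-1 ^+ 2 : R) <= 0 by apply: ln_le0; rewrite expr2; lra.
rewrite invrK.
have h3 : 0 < 1 - 2^-1 ^+ 2 :> R by rewrite expr2; lra.
have := mulr_ge0_le0 (ltW h3) h2; lra.
Qed.

Let f_max : exists2 c, 0 < c < 1 & forall x, 0 < x < 1 -> f x <= f c.
Proof.
have [||c] := @EVT_max R f 100^-1 (1 - 1000^-1).
- lra.
- apply: continuous_in_subspaceT => x; rewrite inE/= in_itv/= => /andP[xl xu].
  have x0 : 0 < x by lra.
  have x1 : 0 < x < 1 by rewrite x0; lra.
  have z0 := sq_lt1 x1.
  have csq : {for x, continuous (fun y : R => y ^+ 2)} by exact: exprn_continuous.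
  have cz : {for x, continuous (fun y : R => 1 - y ^+ 2)}.
    by apply: cvgB; [exact: cvg_cst|exact: csq].
  have cl1 : {for x, continuous (fun y : R => ln (y ^+ 2))}.
    apply: (@continuous_comp _ _ _ (fun y : R => y ^+ 2) (@ln R)) => //.
    by apply: continuous_ln; rewrite exprn_gt0.
  have cl2 : {for x, continuous (fun y : R => ln (1 - y ^+ 2))}.
    apply: (@continuous_comp _ _ _ (fun y : R => 1 - y ^+ 2) (@ln R)) => //.
    exact: continuous_ln.
  rewrite /f /binary_entropy /log2.
  apply: cvgM; last by apply: cvgV; [exact: lt0r_neq0|exact: cvg_id].
  apply: cvgB; (apply: cvgM; last by apply: cvgM; [|exact: cvg_cst]) => //.
  exact: cvgN.
rewrite in_itv/= => /andP[cl cu] cmax.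
exists c; first by apply/andP; split; lra.
have half_le : f 2^-1 <= f c by apply: cmax; rewrite in_itv/=; apply/andP; split; lra.
move=> x /andP[x0 x1].
have [xl|xl] := ltP x 100^-1; last first.
  have [xu|xu] := leP x (1 - 1000^-1); first by apply: cmax; rewrite in_itv/= xl.
  apply: le_trans half_le; rewrite -(ler_pM2r ln2_gt0); apply: le_trans f_half.
  by apply: f_near1; rewrite x1 ltW.
apply: le_trans half_le; rewrite -(ler_pM2r ln2_gt0); apply: le_trans f_half.
have s0 : 0 < Num.sqrt x by rewrite sqrtr_gt0.
rewrite -(sqr_sqrtr (ltW x0)); apply: f_near0; rewrite s0/=.
rewrite leNgt; apply/negP => h.
have := sqr_sqrtr (ltW x0); rewrite expr2; nra.
Qed.

Let gammaE c : 0 < c < 1 -> (forall x, 0 < x < 1 -> f x <= f c) ->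
  gamma R = 2 / 3 * f c.
Proof.
move=> c01 cmax; congr (_ * _); apply/le_anti/andP; split.
- by apply: ge_sup; [exists (f c), c|move=> _ [x x01 <-]; exact: cmax].
- apply: ub_le_sup; last by exists c.
  by exists (f c) => _ [x x01 <-]; exact: cmax.
Qed.

Lemma gamma_attained : exists2 x : R, 0 < x < 1 &
  gamma R = 2 / 3 * (binary_entropy (x ^+ 2) / x).
Proof. by have [c c01 cmax] := f_max; exists c => //; exact: gammaE. Qed.

Lemma gamma_ge x : 0 < x < 1 ->
  2 / 3 * (binary_entropy (x ^+ 2) / x) <= gamma R.
Proof.
move=> x01; have [c c01 cmax] := f_max.
by rewrite (gammaE c01 cmax) ler_pM2l ?divr_gt0//; exact: cmax.
Qed.

End gamma_is_a_maximum.

(* Main.v *)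
Require Import Defs.
From mathcomp Require Import all_boot all_order all_algebra.
From mathcomp Require Import all_classical all_reals all_analysis.
From mathcomp Require Import ring lra zify.
Import Order.TTheory GRing.Theory Num.Theory.
Import numFieldNormedType.Exports.

(* Build a graph by adding vertices so that each new vertex v has minimum degree d in the
   graph obtained.  With x = d / sqrt k, k being the number of old vertices, the
   Kleitman-Winston algorithm bounds the number of neighbourhoods of v by
   exp (sqrt k * f x + o (sqrt n)), f x = ln 2 * H(x^2) / x, because up to a short fingerprint
   the neighbourhood lies in a set of total degree at most (1 + o(1)) k, hence of size at most
   (1 + o(1)) k / d.  Since f'' <= -2, f has a unique maximum point m, so a graph count close
   to gamma would force d = (1 + o(1)) m sqrt k at almost every step.  But vertices whose degree
   exceeds B = 7/6 m sqrt n use up the total degree k too fast to be worth choosing, so the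
   final degrees would essentially stay below B, whereas their average would be
   4/3 m sqrt n > B.  The contradiction is made quantitative by counting each graph with
   weight exp (mu * sum_u max (B - deg u, 0)) >= 1: for d near m sqrt k a new vertex changes
   the exponent by mu (B - 2 d), which is -mu m n^(3/2) / 6 in total to first order. *)

Set Implicit Arguments.
Unset Strict Implicit.
Unset Printing Implicit Defensive.

Local Open Scope set_scope.
Local Open Scope ring_scope.

(** * Independent sets in the common-neighbour graph *)

Section LinearGraphs.
Variable T : finType.
Implicit Types (A : {ffun T -> {set T}}) (U C N M : {set T}) (u v x y z : T).

(* Graphs with vertices in a subset [U] of a fixed type [T] are given by their neighbourhood
   functions; C4-freeness is kept in the form "two vertices have at most one common
   neighbour", which is what survives the removal of a vertex. *)
Definition linear_graph U A : bool :=
  [&& [forall x, A x \subset U], [forall x, x \notin A x],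
      [forall x, forall y, (y \in A x) == (x \in A y)] &
      [forall x, forall y, (x != y) ==> (#|A x :&: A y| <= 1)%N]].

(** Independence in the graph joining two vertices with a common neighbour: a new vertex attached to
    such an [N] lies on no 4-cycle. *)
Definition spread A N : bool :=
  [forall x in N, forall y in N, (x != y) ==> [disjoint A x & A y]].

Lemma linear_sub U A x : linear_graph U A -> A x \subset U.
Proof. by case/and4P=> /forallP. Qed.

Lemma linear_irr U A x : linear_graph U A -> x \notin A x.
Proof. by case/and4P=> _ /forallP. Qed.

Lemma linear_sym U A x y : linear_graph U A -> (y \in A x) = (x \in A y).
Proof. by case/and4P=> _ _ /forallP/(_ x)/forallP/(_ y)/eqP. Qed.

Lemma linear_codeg U A x y :
  linear_graph U A -> x != y -> (#|A x :&: A y| <= 1)%N.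
Proof. by case/and4P=> _ _ _ /forallP/(_ x)/forallP/(_ y)/implyP. Qed.

Lemma spreadP A N :
  reflect {in N &, forall x y, x != y -> [disjoint A x & A y]} (spread A N).
Proof.
apply: (iffP forallP) => [h x y xN yN xy | h x].
  by have /implyP/(_ xN)/forallP/(_ y)/implyP/(_ yN)/implyP/(_ xy) := h x.
apply/implyP => xN; apply/forallP => y; apply/implyP => yN; apply/implyP.
exact: h.
Qed.

Definition codegree A C v : nat :=
  (\sum_(u in C | u != v) #|A u :&: A v|)%N.

Definition far A C v : {set T} :=
  [set u in C | (u != v) && [disjoint A u & A v]]%SET.

(** Distinct vertices have at most one common neighbour, so each [u] other than [v] is counted at
    most once, by one of the two terms. *)
Lemma card_far U A C v : linear_graph U A ->
  (#|far A C v| + codegree A C v <= #|C|)%N.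
Proof.
move=> hA; rewrite /far /codegree -[X in (X + _)%N]sum1_card.
rewrite (eq_bigl (fun u => (u \in C) && (u != v) && [disjoint A u & A v])); last first.
  by move=> u; rewrite inE andbA.
rewrite [X in (X + _)%N]big_mkcondr -big_split /= -[X in (_ <= X)%N]sum1_card.
rewrite [X in (_ <= X)%N](bigID (fun u => u != v)) /=.
apply: leq_trans (leq_addr _ _); apply: leq_sum => u /andP[_ uv].
have := linear_codeg hA uv; rewrite -setI_eq0.
by case: eqP => [->|_] //; rewrite cards0.
Qed.

Lemma sum_degree_incidence U A C : linear_graph U A -> C \subset U ->
  (\sum_(z in U) #|A z :&: C| = \sum_(u in C) #|A u|)%N.
Proof.
move=> hA CU.
under eq_bigr => z _ do rewrite -sum1_card.
under [RHS]eq_bigr => z _ do rewrite -sum1_card.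
rewrite (exchange_big_dep (mem C)) /=; last by move=> z u _; rewrite inE => /andP[].
apply: eq_bigr => u uC; apply: eq_bigl => z; rewrite inE uC andbT.
rewrite (linear_sym _ _ hA); case: (boolP (z \in A u)) => [zu|]; last by rewrite andbF.
by rewrite (fintype.subsetP (linear_sub u hA) _ zu).
Qed.

(** Double counting of the walks [u - z - v] with [u] and [v] in [C]; the degree sum on the left is
    the diagonal [u = v]. *)
Lemma sum_codegree U A C : linear_graph U A -> C \subset U ->
  (\sum_(v in C) codegree A C v + \sum_(u in C) #|A u| =
   \sum_(z in U) #|A z :&: C| ^ 2)%N.
Proof.
move=> hA CU; rewrite -big_split /=.
transitivity (\sum_(v in C) \sum_(u in C) #|A u :&: A v|)%N.
  apply: eq_bigr => v vC; rewrite [RHS](bigD1 v vC) /= finset.setIid addnC.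
  by [].
transitivity (\sum_(v in C) \sum_(z in A v) #|A z :&: C|)%N.
  apply: eq_bigr => v vC.
  under eq_bigr => u _ do rewrite -sum1_card.
  under [RHS]eq_bigr => z _ do rewrite -sum1_card.
  rewrite (exchange_big_dep (mem (A v))) /=; last by move=> z u _; rewrite inE => /andP[].
  apply: eq_bigr => z zv; apply: eq_bigl => u.
  by rewrite !inE zv andbT (linear_sym _ _ hA) andbC.
rewrite (exchange_big_dep (mem U)) /=; last first.
  by move=> v z _; apply: fintype.subsetP; apply: linear_sub hA.
apply: eq_bigr => z zU.
rewrite sum_nat_cond_const expnS expn1; congr (_ * _)%N.
by apply: eq_card => v; rewrite !inE (linear_sym _ _ hA) andbC.
Qed.
End LinearGraphs.

(** * Weighted sums over independent sets and the Kleitman-Winston algorithm *)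

Section KleitmanWinston.
Variables (R : realType) (T : finType).
Implicit Types (A : {ffun T -> {set T}}) (U C N M : {set T}) (u v x y z : T).

Lemma cauchy_schwarz_card (U : {set T}) (a : T -> R) :
  (\sum_(z in U) a z) ^+ 2 <= #|U|%:R * \sum_(z in U) a z ^+ 2.
Proof.
have [U0|U0] := eqVneq #|U| 0%N.
  by rewrite U0 mul0r (cards0_eq U0) big_set0 expr0n.
have k0 : 0 < #|U|%:R :> R by rewrite ltr0n lt0n.
set s := \sum_(z in U) a z; set k : R := #|U|%:R in k0 *.
have : \sum_(z in U) (2 * (s / k) * a z - (s / k) ^+ 2) <= \sum_(z in U) a z ^+ 2.
  apply: ler_sum => z _; rewrite -subr_ge0.
  have -> : a z ^+ 2 - (2 * (s / k) * a z - (s / k) ^+ 2) = (a z - s / k) ^+ 2 by ring.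
  exact: sqr_ge0.
rewrite sumrB -mulr_sumr -/s sumr_const -mulr_natr -/k => h.
have := ler_wpM2l (ltW k0) h; apply: le_trans; rewrite le_eqVlt; apply/orP; left.
by apply/eqP; field; apply: lt0r_neq0.
Qed.

(* By linearity, [codegree A C v] is the degree of [v] inside [C] in the graph joining vertices
   with a common neighbour; its average is bounded below by Cauchy-Schwarz. *)
Lemma exists_codegree U A C (e : R) (D : nat) :
  linear_graph U A -> C \subset U -> 0 < e ->
  {in C, forall u, (D <= #|A u|)%N} ->
  (1 + e) * #|U|%:R < (\sum_(u in C) #|A u|)%:R ->
  exists2 v, v \in C &
    e / (1 + e) * (D%:R ^+ 2 / #|U|%:R) * #|C|%:R <= (codegree A C v)%:R.
Proof.
move=> hA CU e0 degC hs; apply/exists_inP; apply: contraT.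
rewrite negb_exists_in => /forall_inP hle; exfalso.
have {hle} hlt v : v \in C ->
    (codegree A C v)%:R < e / (1 + e) * (D%:R ^+ 2 / #|U|%:R) * #|C|%:R.
  by move=> vC; rewrite ltNge hle.
set s : R := (\sum_(u in C) #|A u|)%:R in hs.
have C0 : (0 < #|C|)%N.
  rewrite card_gt0; apply/negP => /eqP C0; move: hs.
  by rewrite /s C0 big_set0 ltNge mulr_ge0 // addr_ge0 // ltW.
have k0 : 0 < #|U|%:R :> R.
  by rewrite ltr0n (leq_trans C0) // subset_leq_card.
set k : R := #|U|%:R in k0 hs hlt.
have sD : D%:R * #|C|%:R <= s.
  rewrite /s -natrM ler_nat mulnC -sum_nat_const; exact: leq_sum.
set b := e / (1 + e) * (D%:R ^+ 2 / k) in hlt.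
have hsum : (\sum_(v in C) codegree A C v)%:R < b * #|C|%:R * #|C|%:R :> R.
  rewrite natr_sum.
  have [v vC] : exists v, v \in C by apply/card_gt0P.
  have -> : b * #|C|%:R * #|C|%:R = \sum_(v in C) (b * #|C|%:R).
    by rewrite sumr_const mulr_natr.
  rewrite (bigD1 v) //= [ltRHS](bigD1 v) //=; apply: ltr_leD.
    exact: hlt.
  by apply: ler_sum => w /andP[wC _]; apply/ltW/hlt.
have cs := cauchy_schwarz_card U (fun z => #|A z :&: C|%:R).
rewrite -natr_sum (sum_degree_incidence hA CU) -/s -/k in cs.
have hE := congr1 (fun n => n%:R : R) (sum_codegree hA CU).
rewrite natrD -/s [RHS]natr_sum in hE.
rewrite (eq_bigr _ (fun z _ => natrX _ _ _)) in hE.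
have s0 : 0 < s by apply: le_lt_trans hs; rewrite mulr_ge0 ?ltW ?addr_gt0.
have key : k * (b * #|C|%:R * #|C|%:R) <= e / (1 + e) * s ^+ 2.
  have -> : k * (b * #|C|%:R * #|C|%:R) = e / (1 + e) * (D%:R * #|C|%:R) ^+ 2.
    by rewrite /b; field; rewrite !lt0r_neq0 ?addr_gt0.
  rewrite ler_wpM2l ?divr_ge0 ?addr_ge0 ?(ltW e0) //.
  by rewrite ler_sqr ?nnegrE ?mulr_ge0 // ltW.
(* If all codegrees are small, Cauchy-Schwarz forces [s < (1 + e) * k], against [hs]. *)
have h2 : s ^+ 2 < e / (1 + e) * s ^+ 2 + k * s.
  apply: le_lt_trans cs _; rewrite -hE mulrDr ltrD2r.
  by apply: lt_le_trans key; rewrite ltr_pM2l.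
have h3 : (1 + e) * k * s < s ^+ 2 by rewrite expr2 ltr_pM2r.
have h4 : s ^+ 2 < (1 + e) * k * s.
  have -> : (1 + e) * k * s = (1 + e) * (e / (1 + e) * s ^+ 2 + k * s) - e * s ^+ 2.
    by field; rewrite lt0r_neq0 ?addr_gt0.
  have := h2; rewrite -(ltr_pM2l (_ : 0 < 1 + e)) ?addr_gt0 //; nra.
by move: (lt_trans h3 h4); rewrite ltxx.
Qed.

Variable om : T -> R.

(** The multivariate independence polynomial (hard-core partition function) of the common-neighbour
    graph on [C]. *)
Definition indep_sum A C : R :=
  \sum_(N : {set T} | (N \subset C) && spread A N) \prod_(u in N) om u.

Hypothesis om_ge0 : forall u, 0 <= om u.

Let prod_om_ge0 N : 0 <= \prod_(u in N) om u.
Proof. by apply: prodr_ge0 => u _. Qed.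

Lemma indep_sum_le_prod A C : indep_sum A C <= \prod_(u in C) (1 + om u).
Proof.
have -> : \prod_(u in C) (1 + om u) = \sum_(N : {set T} | N \subset C) \prod_(u in N) om u.
  rewrite big_mkcond /=.
  have -> : \prod_u (if u \in C then 1 + om u else 1) =
            \prod_u ((if u \in C then om u else 0) + 1).
    by apply: eq_bigr => u _; case: ifP => _; rewrite ?add0r // addrC.
  rewrite bigA_distr [RHS]big_mkcond /=.
  apply: eq_bigr => N _; case: ifP => NC.
    rewrite [RHS]big_mkcond /=; apply: eq_bigr => u _; case: ifP => // uN.
    by rewrite (fintype.subsetP NC _ uN).
  move/negbT: NC => /subsetPn[u uN uC]; rewrite (bigD1 u) //= uN (negbTE uC) mul0r //.
rewrite /indep_sum [leRHS](bigID (spread A)) /= lerDl.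
exact: sumr_ge0.
Qed.

(** Deletion recursion: in an independent set containing [v], all other members share no neighbour
    with [v] and so lie in [far A C v]. *)
Lemma indep_sum_split A C v : v \in C ->
  indep_sum A C <= indep_sum A (C :\ v) + om v * indep_sum A (far A C v).
Proof.
move=> vC; rewrite /indep_sum (bigID (fun N : {set T} => v \notin N)) /=.
apply: lerD.
  rewrite le_eqVlt; apply/orP; left; apply/eqP/eq_bigl => N.
  by rewrite subsetD1 andbAC.
rewrite mulr_sumr (reindex_onto (fun N => v |: N) (fun N => N :\ v)) /=; last first.
  by move=> N /andP[_]; rewrite negbK => vN; rewrite finset.setD1K.
rewrite big_mkcond [leRHS]big_mkcond /=; apply: ler_sum => N _.
case: ifP => [/andP[/andP[/andP[NC /spreadP sN] _] /eqP Nv]|_]; last first.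
  by case: ifP => // _; rewrite mulr_ge0.
have vN : v \notin N by rewrite -Nv !inE eqxx.
have NC' : N \subset far A C v.
  apply/fintype.subsetP => u uN; have uv : u != v by apply: contraNneq vN => <-.
  rewrite inE uv (fintype.subsetP NC) ?inE ?uN ?orbT //=.
  by apply: sN; rewrite // !inE ?eqxx ?uN ?orbT.
have sN' : spread A N.
  by apply/spreadP => x y xN yN; apply: sN; rewrite !inE ?xN ?yN orbT.
by rewrite NC' sN' /= big_setU1.
Qed.

(* Kleitman-Winston: as long as [C] has total degree above [(1 + e) #|U|], choosing a vertex of
   large codegree shrinks [C] by a factor [exp (- e / (1 + e) * D ^ 2 / #|U|)], so at most [r] get chosen
   before [C] is covered by [Base]. *)
Lemma indep_sum_container U A (e W Base : R) (D r : nat) :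
  linear_graph U A -> 0 < e -> 0 <= W -> (forall u, om u <= W) ->
  {in U, forall u, (D <= #|A u|)%N} ->
  (forall C, C \subset U ->
     (\sum_(u in C) #|A u|)%:R <= (1 + e) * #|U|%:R ->
     \prod_(u in C) (1 + om u) <= Base) ->
  #|U|%:R < expR (e / (1 + e) * (D%:R ^+ 2 / #|U|%:R) * r%:R) ->
  indep_sum A U <= Base * (1 + #|U|%:R * W) ^+ r.
Proof.
move=> hA e0 W0 omW degU hB.
set b := e / (1 + e) * _; set k : R := #|U|%:R.
have B1 : 1 <= Base.
  have := hB finset.set0 (finset.sub0set _); rewrite !big_set0; apply.
  by rewrite mulr_ge0 ?addr_ge0 // ltW.
have X1 : 1 <= 1 + k * W by rewrite lerDl mulr_ge0.
have X0 : 0 <= 1 + k * W by apply: le_trans X1.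
suff H C : C \subset U -> #|C|%:R < expR (b * r%:R) ->
    indep_sum A C <= Base * (1 + k * W) ^+ r by apply: H.
elim: r C => [|r IHr] C CU.
  rewrite mulr0 expR0 ltrn1 => c0; have {}c0 : #|C| = 0%N by move: c0; case: #|C|.
  rewrite (cards0_eq c0).
  apply: le_trans (indep_sum_le_prod _ _) _.
  by rewrite big_set0 expr0 mulr1.
move=> hC.
(* Vertices are deleted one at a time; each adds at most [W] times the bound with one choice fewer,
   so the last factor collects all candidates for the next chosen vertex. *)
suff : indep_sum A C <= Base * (1 + k * W) ^+ r * (1 + #|C|%:R * W).
  move=> h; apply: le_trans h _; rewrite exprSr mulrA ler_wpM2l //.
    by rewrite mulr_ge0 ?exprn_ge0 // (le_trans ler01).
  by rewrite lerD2l ler_wpM2r // ler_nat subset_leq_card.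
have BX0 : 0 <= Base * (1 + k * W) ^+ r.
  by rewrite mulr_ge0 ?exprn_ge0 // (le_trans ler01).
move: {2}#|C| (leqnn #|C|) => c; elim: c C CU hC => [|c IHc] C CU hC cC.
  have -> : C = finset.set0 by apply/eqP; rewrite -cards_eq0; move: cC; case: #|C|.
  apply: le_trans (indep_sum_le_prod _ _) _.
  rewrite big_set0 cards0 mul0r addr0 mulr1.
  by rewrite -[leLHS]mulr1 ler_pM ?exprn_ege1.
have [small|large] := leP ((\sum_(u in C) #|A u|)%:R : R) ((1 + e) * #|U|%:R).
  apply: le_trans (indep_sum_le_prod _ _) _; apply: le_trans (hB _ CU small) _.
  rewrite -mulrA ler_peMr ?(le_trans ler01) //.
  by rewrite mulr_ege1 ?exprn_ege1 // lerDl mulr_ge0.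
have degC : {in C, forall u, (D <= #|A u|)%N}.
  by move=> u uC; apply/degU/(fintype.subsetP CU).
have [v vC hv] := exists_codegree hA CU e0 degC large.
rewrite -/b in hv.
apply: le_trans (indep_sum_split _ vC) _.
have cD : (#|C|%:R : R) = 1 + #|C :\ v|%:R by rewrite (cardsD1 v) vC natrD.
have h1 : indep_sum A (C :\ v) <= Base * (1 + k * W) ^+ r * (1 + #|C :\ v|%:R * W).
  apply: IHc.
  - exact: fintype.subset_trans (subD1set _ _) CU.
  - by apply: le_lt_trans hC; rewrite ler_nat subset_leq_card // subD1set.
  - by rewrite (cardsD1 v) vC in cC.
have h2 : indep_sum A (far A C v) <= Base * (1 + k * W) ^+ r.
  apply: IHr.
    by apply: fintype.subset_trans CU; apply/fintype.subsetP => u; rewrite inE => /andP[].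
  (* Choosing [v] shrinks [C] by the factor [1 - b <= expR (- b)], which pays for lowering [r] by
     one. *)
  have hf : #|far A C v|%:R <= (1 - b) * #|C|%:R.
    have := card_far C v hA; rewrite -(ler_nat R) natrD; lra.
  apply: le_lt_trans hf _.
  have hb : 1 - b <= expR (- b) by have := expR_ge1Dx (- b).
  have -> : b * r%:R = - b + b * r.+1%:R by rewrite -natr1; ring.
  rewrite expRD; apply: le_lt_trans (_ : expR (- b) * #|C|%:R < _).
    by rewrite ler_wpM2r.
  by rewrite ltr_pM2l ?expR_gt0.
apply: le_trans (lerD h1 (ler_pM _ _ (omW v) h2)) _ => //.
  by apply: sumr_ge0.
rewrite cD le_eqVlt; apply/orP; left; apply/eqP; ring.
Qed.
End KleitmanWinston.

(** * Removal of a vertex of minimum degree *)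

Section VertexRemoval.
Variables (R : realType) (T : finType) (mu : R) (B : nat).
Implicit Types (A : {ffun T -> {set T}}) (U V C N M : {set T}) (u v x y z : T).

Lemma ler_sum_inj (I J : finType) (P : pred I) (Q : pred J) (h : I -> J)
    (F : I -> R) (G : J -> R) :
  {in P &, injective h} -> (forall i, P i -> Q (h i)) ->
  (forall i, P i -> F i <= G (h i)) -> (forall j, Q j -> 0 <= G j) ->
  \sum_(i | P i) F i <= \sum_(j | Q j) G j.
Proof.
move=> hinj hPQ hFG G0.
apply: (@le_trans _ _ (\sum_(i | P i) G (h i))); first exact: ler_sum.
have -> : \sum_(i | P i) G (h i) = \sum_(j in [set h i | i in P]%SET) G j.
  by rewrite big_imset.
rewrite [leRHS](bigID (mem [set h i | i in P]%SET)) /= -[leLHS]addr0 lerD //; last first.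
  by apply: sumr_ge0 => j /andP[/G0].
rewrite le_eqVlt; apply/orP; left; apply/eqP/eq_bigl => j.
rewrite andb_idl // => /imsetP[i Pi ->]; exact: hPQ.
Qed.

Definition remove A v : {ffun T -> {set T}} :=
  [ffun u => if u == v then finset.set0 else A u :\ v].

Lemma remove_linear U A v : linear_graph U A -> linear_graph (U :\ v) (remove A v).
Proof.
move=> hA; apply/and4P; split; apply/forallP => x.
- rewrite ffunE; case: eqP => _; first exact: finset.sub0set.
  by apply: finset.setSD; exact: linear_sub hA.
- rewrite ffunE; case: eqP => _; first by rewrite inE.
  by rewrite inE negb_and (linear_irr x hA) orbT.
- apply/forallP => y; rewrite !ffunE; apply/eqP.
  case: (eqVneq x v) => [->|xv]; case: (eqVneq y v) => [->|yv];
    rewrite ?inE ?eqxx ?(negbTE xv) ?(negbTE yv) //=.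
  exact: linear_sym hA.
- apply/forallP => y; apply/implyP => xy.
  apply: leq_trans (linear_codeg hA xy); apply: subset_leq_card.
  rewrite !ffunE; apply: finset.setISS; case: ifP => _;
    by [exact: finset.sub0set | exact: subD1set].
Qed.

Lemma card_remove U A v u : linear_graph U A -> u != v ->
  #|A u| = (#|remove A v u| + (u \in A v))%N.
Proof.
move=> hA uv; rewrite ffunE (negbTE uv) (cardsD1 v (A u)) addnC.
by rewrite (linear_sym _ _ hA).
Qed.

(** Two neighbours of [v] already share [v], hence share nothing else. *)
Lemma spread_neighbors U A v : linear_graph U A -> spread (remove A v) (A v).
Proof.
move=> hA; apply/spreadP => x y xv yv xy; rewrite -setI_eq0.
apply/eqP/finset.setP => z; rewrite !inE; apply/negP => /andP[].
rewrite !ffunE; case: eqP => _; first by rewrite inE.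
case: eqP => _; first by rewrite !inE.
rewrite !inE => /andP[zv zx] /andP[_ zy].
have := linear_codeg hA xy; rewrite leqNgt => /negP; apply.
rewrite (cardsD1 v) inE [v \in A x](linear_sym _ _ hA) [v \in A y](linear_sym _ _ hA) xv yv.
rewrite ltnS card_gt0; apply/set0Pn; exists z.
by rewrite !inE zv zx zy.
Qed.

Lemma remove_inj U v :
  {in linear_graph U &, injective (fun A => (remove A v, A v))}.
Proof.
move=> A A' hA hA' [/ffunP e1 e2]; apply/ffunP => u.
have [->//|uv] := eqVneq u v.
apply/finset.setP => x; have [->|xv] := eqVneq x v.
  by rewrite (linear_sym _ _ hA) (linear_sym _ _ hA') e2.
by have /finset.setP/(_ x) := e1 u; rewrite !ffunE (negbTE uv) !inE xv.
Qed.

(** Truncated subtraction makes each term [max (B - deg u, 0)]. *)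
Definition deficit U A : nat := (\sum_(u in U) (B - #|A u|))%N.

Definition partition_fun U : R :=
  \sum_(A | linear_graph U A) expR (mu * (deficit U A)%:R).

(** The factor for [u] gaining a neighbour: its deficit drops by one exactly when its degree is
    still below [B]. *)
Definition low_weight A u : R := if (#|A u| < B)%N then expR (- mu) else 1.

(** The last condition is the trace of minimality: in the extended graph an old vertex has degree at
    most [#|A u| + 1]. *)
Definition extensible U A N : bool :=
  [&& N \subset U, spread A N & [forall u in U, (#|N| <= #|A u|.+1)%N]].

Definition extension_sum U A : R :=
  \sum_(N : {set T} | extensible U A N)
     expR (mu * (B - #|N|)%:R) * \prod_(u in N) low_weight A u.

Lemma low_weight_gt0 A u : 0 < low_weight A u.
Proof. by rewrite /low_weight; case: ifP => _; rewrite ?expR_gt0. Qed.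

Lemma prod_low_weight_ge0 A N : 0 <= \prod_(u in N) low_weight A u.
Proof. by apply: prodr_ge0 => u _; apply/ltW/low_weight_gt0. Qed.

Lemma deficit_remove U A v : linear_graph U A -> v \in U ->
  (deficit U A + \sum_(u in A v) (#|remove A v u| < B) =
   (B - #|A v|) + deficit (U :\ v) (remove A v))%N.
Proof.
move=> hA vU; rewrite /deficit (big_setD1 v) //= -addnA; congr (_ + _)%N.
have -> : (\sum_(u in A v) (#|remove A v u| < B) =
           \sum_(u in U :\ v) (u \in A v) * (#|remove A v u| < B))%N.
  rewrite big_mkcond [RHS]big_mkcond /=; apply: eq_bigr => u _.
  case: (boolP (u \in A v)) => [uv|_]; last by rewrite mul0n; case: ifP.
  rewrite mul1n !inE (fintype.subsetP (linear_sub v hA) _ uv) andbT.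
  case: (eqVneq u v) uv => [->|//]; by rewrite (negbTE (linear_irr v hA)).
rewrite -big_split /=; apply: eq_bigr => u; rewrite !inE => /andP[uv _].
rewrite (card_remove hA uv); case: (u \in A v); rewrite /= ?mul1n ?mul0n; lia.
Qed.

Lemma weight_remove U A v : linear_graph U A -> v \in U ->
  expR (mu * (deficit U A)%:R) =
  expR (mu * (deficit (U :\ v) (remove A v))%:R) *
   (expR (mu * (B - #|A v|)%:R) * \prod_(u in A v) low_weight (remove A v) u).
Proof.
move=> hA vU.
have -> : \prod_(u in A v) low_weight (remove A v) u =
   expR (- (mu * (\sum_(u in A v) (#|remove A v u| < B))%:R)).
  rewrite natr_sum mulr_sumr -sumrN expR_sum; apply: eq_bigr => u _.
  by rewrite /low_weight; case: ifP => _; rewrite ?mulr1 // mulr0 oppr0 expR0.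
rewrite -!expRD; congr expR.
have := congr1 (fun n => n%:R : R) (deficit_remove hA vU).
rewrite !natrD => h.
have -> : (deficit U A)%:R = (B - #|A v|)%:R + (deficit (U :\ v) (remove A v))%:R
   - (\sum_(u in A v) (#|remove A v u| < B))%:R :> R by rewrite -h addrK.
ring.
Qed.

(** Every graph has a vertex [v] of minimum degree; summing over all such [v] only overcounts, and
    [(remove A v, A v)] determines [A]. *)
Lemma partition_fun_le U (b : R) : (0 < #|U|)%N ->
  (forall v A, v \in U -> linear_graph (U :\ v) A -> extension_sum (U :\ v) A <= b) ->
  partition_fun U <= \sum_(v in U) partition_fun (U :\ v) * b.
Proof.
move=> U0 hb.
pose mindeg A v := [forall u in U, (#|A v| <= #|A u|)%N].
apply: (@le_trans _ _ (\sum_(A | linear_graph U A) \sum_(v in U | mindeg A v)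
    expR (mu * (deficit U A)%:R))).
  apply: ler_sum => A _; have [v0 v0U] : exists v, v \in U by apply/card_gt0P.
  case: (@arg_minnP _ v0 (mem U) (fun v => #|A v|) v0U) => v vU vmin.
  have vm : (v \in U) && mindeg A v by apply/andP; split; [exact: vU | exact/forall_inP].
  rewrite (bigD1 v) //= lerDl; apply: sumr_ge0 => u _; exact: expR_ge0.
rewrite (exchange_big_dep (mem U)) /=; last by move=> A v _ /andP[].
apply: ler_sum => v vU.
apply: (@le_trans _ _ (\sum_(A | linear_graph (U :\ v) A)
    expR (mu * (deficit (U :\ v) A)%:R) * extension_sum (U :\ v) A)); last first.
  rewrite /partition_fun mulr_suml; apply: ler_sum => A hA.
  by rewrite ler_wpM2l ?expR_ge0 //; apply: hb.
rewrite /extension_sum; under [leRHS]eq_bigr do rewrite mulr_sumr.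
rewrite pair_big_dep /=.
apply: (ler_sum_inj (h := fun A => (remove A v, A v))).
- by move=> A A' /andP[hA _] /andP[hA' _]; apply: (remove_inj hA hA').
- move=> A /andP[hA /andP[_ /forall_inP hm]] /=.
  rewrite (remove_linear v hA) /=; apply/and3P; split.
  + rewrite subsetD1 (linear_sub v hA); exact: linear_irr hA.
  + exact: spread_neighbors hA.
  + apply/forall_inP => u; rewrite !inE => /andP[uv uU].
    apply: leq_trans (hm u uU) _; rewrite (card_remove hA uv) addnC.
    by case: (u \in A v).
- by move=> A /andP[hA /andP[_ _]] /=; rewrite (weight_remove hA vU).
- by move=> [A N] _ /=; rewrite !mulr_ge0 ?expR_ge0 ?prod_low_weight_ge0.
Qed.

(** The factor [k.+1] counts the choices of the vertex removed from a set of that size; together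
    these give a factorial, of lower order. *)
Lemma partition_fun_le_prod U (b : nat -> R) : (forall k, 0 <= b k) ->
  (forall V A, (#|V| < #|U|)%N -> linear_graph V A -> extension_sum V A <= b #|V|) ->
  partition_fun U <= \prod_(k < #|U|) (k.+1%:R * b k).
Proof.
move=> b0; move Hm : #|U| => m; elim: m U Hm => [|m IHm] U Hm hb.
  have U0 : U = finset.set0 by apply: cards0_eq.
  rewrite big_ord0 /partition_fun (eq_bigl (pred1 [ffun=> finset.set0])).
    by rewrite big_pred1_eq /deficit U0 big_set0 mulr0 expR0.
  move=> A /=; apply/idP/eqP => [hA|->].
    apply/ffunP => x; rewrite ffunE; apply/eqP; rewrite -finset.subset0 -U0.
    exact: linear_sub hA.
  apply/and4P; split; apply/forallP => x; rewrite ?ffunE ?inE ?finset.sub0set //.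
    by apply/forallP => y; rewrite !ffunE !inE.
  by apply/forallP => y; rewrite !ffunE finset.setI0 cards0 implybT.
have cV v : v \in U -> #|U :\ v| = m.
  by move=> vU; move: Hm; rewrite (cardsD1 v) vU => -[].
apply: le_trans (@partition_fun_le U (b m) _ _) _; first by rewrite Hm.
  by move=> v A vU hA; rewrite -(cV v vU); apply: hb => //; rewrite (cV v vU).
rewrite big_ord_recr /=.
apply: le_trans (ler_sum _ (G := fun=> \prod_(k < m) (k.+1%:R * b k) * b m) _) _.
  move=> v vU; rewrite ler_wpM2r //; apply: IHm; first exact: cV.
  by move=> V A hV; apply: hb; apply: leqW.
rewrite sumr_const Hm -mulr_natr le_eqVlt; apply/orP; left; apply/eqP; ring.
Qed.

End VertexRemoval.

(** * From labelled C4-free graphs to neighbourhood functions *)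

Section CountGraphs.
Variables (R : realType) (T : finType).
Implicit Types (E : {set {set T}}).

Definition neighbors E : {ffun T -> {set T}} := [ffun x => [set y | adj E x y]]%SET.

Lemma adjC E x y : adj E x y = adj E y x.
Proof. by rewrite /adj finset.setUC. Qed.

Lemma neighbors_inj : {in @is_graph T &, injective neighbors}.
Proof.
have sub E E' e : is_graph E -> neighbors E = neighbors E' -> e \in E -> e \in E'.
  move=> /forall_inP hE /ffunP nEE' eE; have /cards2P[x [y [_ exy]]] := hE _ eE.
  by have /finset.setP/(_ y) := nEE' x; rewrite !ffunE !inE /adj -exy eE.
move=> E E' hE hE' eqn; apply/finset.setP => e.
by apply/idP/idP; apply: sub.
Qed.

(** Two common neighbours [z], [w] of distinct [x], [y] give the 4-cycle [x z y w]. *)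
Lemma C4_free_linear E : is_graph E -> C4_free E -> linear_graph [set: T]%SET (neighbors E).
Proof.
move=> /forall_inP hE hC.
have irr x : adj E x x = false.
  by apply/negP => /hE; rewrite finset.setUid cards1.
apply/and4P; split; apply/forallP => x.
- exact: finset.subsetT.
- by rewrite ffunE inE irr.
- by apply/forallP => y; rewrite !ffunE !inE adjC.
apply/forallP => y; apply/implyP => xy; rewrite leqNgt; apply/negP.
case/card_gt1P => z [w [zI wI zw]]; move: zI wI.
rewrite !inE !ffunE !inE => /andP[xz yz] /andP[xw yw].
have nadj a b : adj E a b -> a != b.
  by move=> ab; apply: contraTneq ab => ->; rewrite irr.
move/existsP: hC; apply; exists [tuple x; z; y; w].
rewrite /ucycleb /= xz (adjC E z) yz yw (adjC E w) xw /= !inE !negb_or.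
rewrite (nadj _ _ xz) xy (nadj _ _ xw) zw (nadj _ _ yw) eq_sym (nadj _ _ yz).
by [].
Qed.
End CountGraphs.

Lemma num_C4_free_le (R : realType) (n B : nat) (mu : R) : 0 <= mu ->
  (num_C4_free n)%:R <= partition_fun mu B [set: 'I_n]%SET.
Proof.
move=> mu0; rewrite /num_C4_free -sum1_card natr_sum /partition_fun.
apply: (ler_sum_inj (h := @neighbors 'I_n)).
- move=> E E'; rewrite !inE => /andP[gE _] /andP[gE' _]; exact: neighbors_inj.
- by move=> E; rewrite inE => /andP[gE cE]; apply: C4_free_linear.
- by move=> E _; rewrite -expR0 ler_expR mulr_ge0.
- by move=> A _; exact: expR_ge0.
Qed.

(** * The entropy function *)

Section EntropyFunction.
Variable R : realType.
Implicit Types x y : R.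

(** On the open unit interval this is [ln 2 * H(x^2) / x]. *)
Definition entropy_fun x : R := - (2 * (x * ln x)) + (x - x^-1) * ln (1 - x ^+ 2).

Definition entropy_deriv x : R := - (2 * ln x) + (1 + (x ^+ 2)^-1) * ln (1 - x ^+ 2).

Lemma onem_sqr_gt0 x : 0 < x < 1 -> 0 < 1 - x ^+ 2.
Proof. by move=> /andP[x0 x1]; rewrite expr2; nra. Qed.

Lemma ln2_gt0 : 0 < ln (2 : R).
Proof. by rewrite ln_gt0// ltr1n. Qed.

Lemma binary_entropyE x : 0 < x < 1 ->
  binary_entropy (x ^+ 2) / x = entropy_fun x / ln 2.
Proof.
move=> x01; have /andP[x0 _] := x01; rewrite /binary_entropy /log2 /entropy_fun lnXn //.
have l2 := lt0r_neq0 ln2_gt0.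
have xn := lt0r_neq0 x0.
by rewrite expr2 mulr2n; field; rewrite l2 xn.
Qed.

Lemma is_derive_entropy_fun x : 0 < x < 1 -> is_derive x 1 entropy_fun (entropy_deriv x).
Proof.
move=> x01; have s0 := onem_sqr_gt0 x01; have /andP[x0 x1] := x01.
have xn := lt0r_neq0 x0; have sn := lt0r_neq0 s0.
have dl : is_derive x 1 (@ln R) x^-1 by exact: is_derive1_ln.
have d1 : is_derive x 1 (fun y : R => 1 - y ^+ 2) (- (2 * x)).
  by apply: is_derive_eq; rewrite /= !scaler1 /GRing.scale /=; ring.
have dl2 : is_derive x 1 (fun y : R => ln (1 - y ^+ 2)) (- (2 * x) / (1 - x ^+ 2)).
  have := @is_derive1_comp R (@ln R) (fun y : R => 1 - y ^+ 2) x _ _ (is_derive1_ln s0) d1.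
  by rewrite mulrC.
have di : is_derive x 1 (fun y : R => y^-1) (- x ^- 2).
  by apply: is_derive_eq; [exact: (is_deriveV (f := id) xn)|rewrite scaler1].
have d3 : is_derive x 1 (fun y : R => - (2 * (y * ln y))) (- (2 * (ln x + 1))).
  by apply: is_derive_eq; rewrite /GRing.scale /=; field.
have d4 : is_derive x 1 (fun y : R => (y - y^-1) * ln (1 - y ^+ 2))
    ((1 + x ^- 2) * ln (1 - x ^+ 2) + 2).
  by apply: is_derive_eq; rewrite /GRing.scale /=; field; rewrite ?xn ?sn.
have := is_deriveD d3 d4.
congr is_derive; rewrite /entropy_deriv; ring.
Qed.

(** A form of [f'' <= -2] without second derivatives: [ln] has slope at least 1 on (0, 1), while
    [ln (1 - t)] and, by concavity, [ln (1 - t) / t] decrease in [t = x^2]. *)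
Lemma entropy_deriv_mono x y : 0 < x -> x <= y -> y < 1 ->
  entropy_deriv y + 2 * y <= entropy_deriv x + 2 * x.
Proof.
move=> x0 xy y1; have y0 := lt_le_trans x0 xy.
have l1 : y - x <= ln y - ln x.
  have : ln (x / y) <= x / y - 1.
    rewrite -[X in ln X](subrK 1) [X in ln X]addrC; apply: le_ln1Dx.
    by rewrite ltrBrDr addNr divr_gt0.
  rewrite ln_div ?posrE // => h.
  have : x / y - 1 <= x - y.
    rewrite -(ler_pM2r y0) mulrBl divfK ?lt0r_neq0 // mul1r; nra.
  lra.
have sx : 0 < 1 - x ^+ 2 by apply: onem_sqr_gt0; rewrite x0 (le_lt_trans xy).
have sy : 0 < 1 - y ^+ 2 by apply: onem_sqr_gt0; rewrite y0.
set a := x ^+ 2 in sx *; set b := y ^+ 2 in sy *.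
have a0 : 0 < a by rewrite exprn_gt0.
have ab : a <= b by rewrite ler_sqr // nnegrE ltW.
have b0 := lt_le_trans a0 ab.
have lab : ln (1 - b) <= ln (1 - a) by rewrite ler_ln ?posrE // lerD2l lerN2.
have cc : ln (1 - b) / b <= ln (1 - a) / a.
  have t01 : 0 <= a / b <= 1.
    by rewrite (divr_ge0 (ltW a0) (ltW b0)) ler_pdivrMr // mul1r.
  pose t : {i01 R} := Itv01 (andP t01).1 (andP t01).2.
  have := @concave_ln R t (1 - b) 1 sy ltr01.
  rewrite !convRE /= ln1 mulr0 addr0 /unstable.onem mulr1.
  have -> : a / b * (1 - b) + (1 - a / b) = 1 - a by field; exact: lt0r_neq0.
  move=> h; rewrite ler_pdivlMr //; apply: le_trans h.
  by rewrite le_eqVlt; apply/orP; left; apply/eqP; ring.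
rewrite /entropy_deriv -/a -/b !mulrDl !mul1r ![_^-1 * _]mulrC; lra.
Qed.

Lemma entropy_fun_strict_max : exists2 m, 0 < m < 1 &
  forall x, 0 < x < 1 -> entropy_fun x <= 3 / 2 * gamma R * ln 2 - (x - m) ^+ 2.
Proof.
have [m m01 gE] := gamma_attained R; exists m => //.
rewrite binary_entropyE // in gE.
have l2 := ln2_gt0; have l2n := lt0r_neq0 l2.
have -> : 3 / 2 * gamma R * ln 2 = entropy_fun m by rewrite gE; field.
have fmax x : 0 < x < 1 -> entropy_fun x <= entropy_fun m.
  move=> x01; have := gamma_ge x01; rewrite gE binary_entropyE //.
  by rewrite ler_pM2l ?divr_gt0 // ler_pM2r ?invr_gt0.
have dm0 : entropy_deriv m = 0.
  have d0 : is_derive m 1 entropy_fun 0.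
    have mI : m \in `]0, 1[ by rewrite in_itv.
    apply: (@derive1_at_max _ entropy_fun 0 1 m ler01 _ mI).
    - move=> t; rewrite in_itv /= => t01.
      by have [] := is_derive_entropy_fun t01.
    - by move=> t; rewrite in_itv /= => /fmax.
  have d1 := is_derive_entropy_fun m01.
  by rewrite -(@derive_val _ _ _ _ _ _ _ d1) (@derive_val _ _ _ _ _ _ _ d0).
(* By [entropy_deriv_mono] and [dm0], the derivative of [g] is nonnegative before [m] and
   nonpositive after, so [g] is largest at [m]. *)
pose g x := entropy_fun x + (x - m) ^+ 2.
have gd x : 0 < x < 1 -> is_derive x 1 g (entropy_deriv x + 2 * (x - m)).
  move=> x01; have df := is_derive_entropy_fun x01.
  have d2 : is_derive x 1 (fun y : R => (y - m) ^+ 2) (2 * (x - m)).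
    by apply: is_derive_eq; rewrite /GRing.scale /=; ring.
  exact: is_deriveD df d2.
have gcont a b : 0 < a -> b < 1 -> {within `[a, b], continuous g}%classic.
  move=> a0 b1; apply: continuous_in_subspaceT => x; rewrite inE /= in_itv /= => /andP[xa xb].
  have x01 : 0 < x < 1 by rewrite (lt_le_trans a0) // (le_lt_trans xb).
  have [+ _] := gd x x01; move=> /derivable1_diffP; exact: differentiable_continuous.
move=> x x01; rewrite lerBrDr -/(g x).
have -> : entropy_fun m = g m by rewrite /g subrr expr0n addr0.
have /andP[x0 x1] := x01; have /andP[m0 m1] := m01.
have [xm|mx|->//] := ltgtP x m.
  have gd' y : y \in `]x, m[ -> is_derive y 1 g (entropy_deriv y + 2 * (y - m)).
    by rewrite in_itv /= => /andP[xy ym]; apply: gd; rewrite (lt_trans x0) // (lt_trans ym).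
  have [y] := MVT xm gd' (gcont _ _ x0 m1); rewrite in_itv /= => /andP[xy ym] gE'.
  rewrite -subr_ge0 gE'; apply: mulr_ge0; last by rewrite subr_ge0 ltW.
  have := entropy_deriv_mono (lt_trans x0 xy) (ltW ym) m1; rewrite dm0; lra.
have gd' y : y \in `]m, x[ -> is_derive y 1 g (entropy_deriv y + 2 * (y - m)).
  by rewrite in_itv /= => /andP[my yx]; apply: gd; rewrite (lt_trans m0) // (lt_trans yx).
have [y] := MVT mx gd' (gcont _ _ m0 x1); rewrite in_itv /= => /andP[my yx] gE'.
rewrite -subr_le0 gE'; apply: mulr_le0_ge0; last by rewrite subr_ge0 ltW.
have := entropy_deriv_mono m0 (ltW my) (lt_trans yx x1); rewrite dm0; lra.
Qed.

(** Evaluation at [x = 1/2], where [entropy_fun] is [ln 2 + 3/2 * ln (4/3)], with [(4/3)^3 >= 2]. *)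
Lemma gamma_ln2_ge : 3 / 2 * ln 2 <= 3 / 2 * gamma R * ln 2.
Proof.
have h01 : 0 < (2^-1 : R) < 1 by apply/andP; split; lra.
have := gamma_ge h01; rewrite binary_entropyE //.
have l2 := ln2_gt0; have l2n := lt0r_neq0 l2.
suff : 3 / 2 * ln 2 <= entropy_fun 2^-1.
  move=> h1 h2; apply: le_trans h1 _.
  have := h2; rewrite -(ler_pM2r l2) => h3.
  have -> : entropy_fun 2^-1 = 3 / 2 * (2 / 3 * (entropy_fun 2^-1 / ln 2) * ln 2) by field.
  rewrite -[leRHS]mulrA ler_wpM2l //; lra.
have h43 : ln 2 <= 3 * ln (4 / 3 : R).
  rewrite mulr_natl -lnXn; last lra.
  have p : 0 < (4 / 3 : R) by lra.
  by rewrite ler_ln ?posrE ?exprn_gt0 // !exprS expr0; lra.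
rewrite /entropy_fun invrK.
have -> : 1 - 2^-1 ^+ 2 = (4 / 3)^-1 :> R by rewrite expr2; field.
rewrite !lnV ?posrE //; lra.
Qed.
End EntropyFunction.

(** * Neighbourhoods of a given size *)

Section ExtensionBounds.
Variables (R : realType) (T : finType) (B : nat).
Implicit Types (A : {ffun T -> {set T}}) (U V C N M : {set T}) (u v x y z : T).
Implicit Types (mu h l e : R) (d k n : nat).

(* Up to the factor [expR (- h)], the fugacity [l] times an upper bound for [low_weight]; the
   freedom in [h] makes it possible to switch the degree weights off. *)
Definition tilted A l h u : R := l * (if (#|A u| < B)%N then 1 else expR h).

Definition sized_sum mu U A d : R :=
  \sum_(N : {set T} | extensible U A N && (#|N| == d))
     expR (mu * (B - d)%:R) * \prod_(u in N) low_weight mu B A u.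

Lemma tilted_ge0 A l h u : 0 <= l -> 0 <= tilted A l h u.
Proof. by move=> l0; rewrite mulr_ge0 //; case: ifP => _; rewrite ?expR_ge0. Qed.

Lemma tilted_le A l h u : 0 <= l -> 0 <= h -> tilted A l h u <= l * expR h.
Proof.
by move=> l0 h0; rewrite ler_wpM2l //; case: ifP => _ //; rewrite -expR0 ler_expR.
Qed.

Lemma extension_sum_sized mu U A (n : nat) (s : R) : (#|U| <= n)%N ->
  (forall d, sized_sum mu U A d <= s) ->
  extension_sum mu B U A <= n.+1%:R * s.
Proof.
move=> Un hs.
rewrite /extension_sum (partition_big (fun N : {set T} => inord #|N| : 'I_n.+1) xpredT) //=.
have -> : n.+1%:R * s = \sum_(d < n.+1) s.
  by rewrite sumr_const card_ord mulr_natl.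
apply: ler_sum => d _; apply: le_trans (hs d).
rewrite /sized_sum le_eqVlt; apply/orP; left; apply/eqP.
have cN N : extensible U A N -> (inord #|N| == d :> 'I_n.+1) = (#|N| == d).
  move=> /and3P[NU _ _]; rewrite -val_eqE /= inordK // ltnS.
  exact: leq_trans (subset_leq_card NU) Un.
rewrite (eq_bigl (fun N => extensible U A N && (#|N| == d))); last first.
  by move=> N /=; case: (boolP (extensible U A N)) => // /cN ->.
by apply: eq_bigr => N /andP[_ /eqP ->].
Qed.

(** Rankin's trick: each of the [d] factors [low_weight] is at most [expR (- h) / l] times [tilted],
    after which the size and degree restrictions are dropped. *)
Lemma sized_sum_tilted mu U A d l h : 0 < l -> 0 <= h <= mu ->
  sized_sum mu U A d <=
  expR (mu * (B - d)%:R - h * d%:R - d%:R * ln l) * indep_sum (tilted A l h) A U.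
Proof.
move=> l0 /andP[h0 hmu]; rewrite /sized_sum /indep_sum mulr_sumr.
rewrite big_mkcond [leRHS]big_mkcond /=; apply: ler_sum => N _.
have P0 : 0 <= \prod_(u in N) tilted A l h u.
  by apply: prodr_ge0 => u _; apply: tilted_ge0; apply: ltW.
case: ifP => [/andP[/and3P[-> -> _] /eqP Nd]|_]; last first.
  by case: ifP => // _; rewrite mulr_ge0 ?expR_ge0.
rewrite -addrA expRD -mulrA ler_wpM2l ?expR_ge0 //=.
have -> : - (h * d%:R) - d%:R * ln l = \sum_(u in N) (- h - ln l).
  by rewrite sumr_const Nd -mulr_natr; ring.
rewrite expR_sum -big_split /=; apply: ler_prod => u _.
rewrite ltW ?low_weight_gt0 //= /low_weight /tilted.
rewrite -{2}(@lnK _ l) ?posrE //; case: ifP => _.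
  by rewrite mulr1 -expRD ler_expR; lra.
by rewrite -!expRD -expR0 ler_expR; lra.
Qed.

(** Each factor is charged to its degree, as [expR ((deg u + 1) / (d + 1) * ln (1 + l))]. The
    disjunction on [h] says that a vertex of degree at least [B] can pay for its larger fugacity in
    this way. *)
Lemma prod_tilted_le U A C d l h e :
  0 < l -> 0 <= h -> 0 < e -> 1 <= e * d%:R -> C \subset U ->
  {in U, forall u, (d <= #|A u|)%N} ->
  h = 0 \/ ln (1 + l * expR h) <= B.+1%:R / d.+1%:R * ln (1 + l) ->
  (\sum_(u in C) #|A u|)%:R <= (1 + e) * #|U|%:R ->
  \prod_(u in C) (1 + tilted A l h u) <=
    expR ((1 + e) ^+ 2 * #|U|%:R / d.+1%:R * ln (1 + l)).
Proof.
move=> l0 h0 e0 ed CU degU hh hC.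
have d0 : 0 < d%:R :> R.
  by rewrite lt_neqAle ler0n andbT; apply/eqP => dE; move: ed; rewrite -dE mulr0 ler10.
have L0 : 0 < ln (1 + l) by rewrite ln_gt0 // ltrDl.
have D0 : 0 < d.+1%:R :> R by rewrite ltr0n.
apply: (@le_trans _ _ (\prod_(u in C) expR ((#|A u|.+1)%:R / d.+1%:R * ln (1 + l)))).
  apply: ler_prod => u uC; have uU := fintype.subsetP CU _ uC.
  rewrite addr_ge0 ?tilted_ge0 ?(ltW l0) //=.
  have h1 : 1 + l <= expR (#|A u|.+1%:R / d.+1%:R * ln (1 + l)).
    rewrite -ler_ln ?posrE ?expR_gt0 ?addr_gt0 // expRK.
    rewrite ler_peMl ?(ltW L0) // ler_pdivlMr // mul1r ler_nat ltnS; exact: degU.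
  rewrite /tilted; case: ltnP => hB; first by rewrite mulr1.
  case: hh => [->|hh]; first by rewrite expR0 mulr1.
  rewrite -ler_ln ?posrE ?expR_gt0 ?addr_gt0 ?mulr_gt0 ?expR_gt0 // expRK.
  apply: le_trans hh _; rewrite ler_wpM2r ?(ltW L0) // ler_pM2r ?invr_gt0 //.
  by rewrite ler_nat.
rewrite -expR_sum ler_expR -!mulr_suml ler_wpM2r ?(ltW L0) //.
rewrite ler_pM2r ?invr_gt0 //.
have -> : \sum_(u in C) #|A u|.+1%:R = (\sum_(u in C) #|A u|)%:R + #|C|%:R :> R.
  by rewrite natr_sum -sum1_card natr_sum -big_split /=; apply: eq_bigr => u _; rewrite natr1.
have hd : d%:R * #|C|%:R <= (1 + e) * #|U|%:R :> R.
  apply: le_trans hC; rewrite -natrM ler_nat mulnC -sum_nat_const.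
  by apply: leq_sum => u uC; apply/degU/(fintype.subsetP CU).
have : #|C|%:R <= e * ((1 + e) * #|U|%:R).
  apply: le_trans (_ : e * (d%:R * #|C|%:R) <= _); last by rewrite ler_pM2l.
  by rewrite mulrA ler_peMl.
by move=> hc; have := lerD hC hc; rewrite expr2; lra.
Qed.

Lemma indep_sum_tilted U A d l h e r :
  linear_graph U A ->
  0 < l -> 0 <= h -> 0 < e -> 1 <= e * d%:R ->
  {in U, forall u, (d <= #|A u|)%N} ->
  h = 0 \/ ln (1 + l * expR h) <= B.+1%:R / d.+1%:R * ln (1 + l) ->
  #|U|%:R < expR (e / (1 + e) * (d%:R ^+ 2 / #|U|%:R) * r%:R) ->
  indep_sum (tilted A l h) A U <=
    expR ((1 + e) ^+ 2 * #|U|%:R / d.+1%:R * ln (1 + l)) *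
    (1 + #|U|%:R * (l * expR h)) ^+ r.
Proof.
move=> hA l0 h0 e0 ed degU hh hr.
apply: (indep_sum_container _ hA e0 _ _ degU _ hr).
- by move=> u; apply/tilted_ge0/ltW.
- by rewrite mulr_ge0 ?expR_ge0 // ltW.
- by move=> u; apply: tilted_le => //; apply: ltW.
- by move=> C CU; apply: prod_tilted_le.
Qed.
End ExtensionBounds.

(** * Fingerprint size and elementary logarithmic estimates *)

Section Asymptotics.
Variable R : realType.
Implicit Types (x y e l h mu m : R) (d k n r : nat).

Lemma ln_le_sub1 x : 0 < x -> ln x <= x - 1.
Proof.
move=> x0; rewrite -[X in ln X](subrK 1) [X in ln X]addrC; apply: le_ln1Dx.
by rewrite ltrBrDr addNr.
Qed.

(* Here and below [y = n^(1/16)]: degrees below [y^6 = n^(3/8)] are handled by the trivial bound,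
   and for larger ones the fingerprint contributes [O(y^6)], against [sqrt n = y^8]. *)
Lemma fingerprint_cost e : 0 < e -> exists2 Y, 1 <= Y & forall y n k d,
  Y <= y -> y ^+ 16 = n%:R -> (0 < k <= n)%N -> y ^+ 6 <= d.+1%:R ->
  1 <= e * d%:R /\
  exists2 r, k%:R < expR (e / (1 + e) * (d%:R ^+ 2 / k%:R) * r%:R) &
    forall W, 0 <= W <= 15 -> (1 + k%:R * W) ^+ r <= expR (e * y ^+ 8).
Proof.
move=> e0; have e1 : 0 < 1 + e by rewrite addr_gt0.
(* [C * y^5] bounds [r]: [ln k <= 16 * y] is divided by [b >= e / (4 * (1 + e)) * y^-4], and 1 is
   added for rounding. *)
pose C := 64 * (1 + e) / e + 1.
have C1 : 1 <= C by rewrite lerDr ?divr_ge0 ?mulr_ge0 ?(ltW e0) ?(ltW e1).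
have i0 : 0 < e^-1 by rewrite invr_gt0.
(* The summands ensure [y >= 2], [e * y >= 2] and [e * y >= 31 * C]; 31 comes from
   [ln (16 * y^16) <= 31 * y]. *)
exists (2 + 2 / e + 31 * C / e).
  have : 0 < 31 * C / e by rewrite divr_gt0 //; lra.
  have : 0 < 2 / e by rewrite divr_gt0.
  lra.
move=> y n k d; set Y := _ + _ => Yy yn /andP[k0 kn] yd.
have p31 : 0 < 31 * C / e by rewrite divr_gt0 //; lra.
have p2 : 0 < 2 / e by rewrite divr_gt0.
have y2 : 2 <= y by rewrite /Y in Yy; lra.
have ye : 2 / e <= y by rewrite /Y in Yy; lra.
have yC : 31 * C / e <= y by rewrite /Y in Yy; lra.
have y0 : 0 < y by lra.
have y1 : 1 <= y by lra.
have y6 : y <= y ^+ 6 by rewrite -[leLHS]expr1 ler_weXn2l.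
have d2 : y ^+ 6 / 2 <= d%:R.
  have : d.+1%:R = d%:R + 1 :> R by rewrite natr1.
  lra.
have ed : 1 <= e * d%:R.
  have : 1 <= e * (y ^+ 6 / 2).
    have : 2 <= e * y by rewrite mulrC -ler_pdivrMr.
    have : e * y <= e * y ^+ 6 by rewrite ler_pM2l.
    lra.
  by move=> h; apply: le_trans h _; rewrite ler_pM2l.
split=> //.
have kR0 : 0 < k%:R :> R by rewrite ltr0n.
have kRn : k%:R <= y ^+ 16 by rewrite yn ler_nat.
pose b := e / (1 + e) * (d%:R ^+ 2 / k%:R).
have b_ge : e / (4 * (1 + e)) * y ^- 4 <= b.
  have hd : y ^+ 12 / 4 <= d%:R ^+ 2.
    have -> : y ^+ 12 / 4 = (y ^+ 6 / 2) ^+ 2 by rewrite expr_div_n -exprM; congr (_ / _); ring.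
    rewrite ler_sqr ?nnegrE //; apply: divr_ge0 => //; exact/exprn_ge0/ltW.
  have hk : y ^- 16 <= k%:R^-1.
    by rewrite lef_pV2 ?posrE // exprn_gt0.
  have := ler_pM _ _ hd hk => /(_ _ _) h.
  have -> : e / (4 * (1 + e)) * y ^- 4 = e / (1 + e) * (y ^+ 12 / 4 * y ^- 16).
    by field; rewrite (lt0r_neq0 y0) lt0r_neq0.
  rewrite /b ler_pM2l ?divr_gt0 //; apply: h.
    apply: divr_ge0 => //; exact/exprn_ge0/ltW.
  by rewrite invr_ge0 exprn_ge0 // ltW.
have b0 : 0 < b.
  apply: lt_le_trans b_ge; rewrite mulr_gt0 ?divr_gt0 ?mulr_gt0 ?invr_gt0 ?exprn_gt0 //.
have lny : ln y <= y - 1 by exact: ln_le_sub1.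
have lnk : ln k%:R <= 16 * y.
  have : ln k%:R <= ln (y ^+ 16) by rewrite ler_ln ?posrE ?exprn_gt0.
  rewrite lnXn // -mulr_natl; lra.
have lnk0 : 0 <= ln (k%:R : R) by apply: ln_ge0; rewrite ler1n.
pose r := (Num.trunc (ln k%:R / b)).+1.
have r_gt : ln k%:R / b < r%:R by exact: truncnS_gt.
have r_le : r%:R <= C * y ^+ 5.
  have h1 : r%:R <= ln k%:R / b + 1.
    by rewrite -natr1 lerD2r truncn_le divr_ge0 // ltW.
  have h2 : ln k%:R / b <= 64 * (1 + e) / e * y ^+ 5.
    rewrite ler_pdivrMr //; apply: le_trans lnk _.
    apply: le_trans (_ : 64 * (1 + e) / e * y ^+ 5 * (e / (4 * (1 + e)) * y ^- 4) <= _).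
      rewrite le_eqVlt; apply/orP; left; apply/eqP; field.
      by rewrite (lt0r_neq0 y0) !lt0r_neq0.
    rewrite ler_wpM2l // mulr_ge0 ?exprn_ge0 ?(ltW y0) // divr_ge0 ?mulr_ge0 ?(ltW e0) ?(ltW e1) //.
  have h3 : 1 <= y ^+ 5 by rewrite exprn_ege1.
  apply: le_trans h1 _; rewrite /C mulrDl mul1r lerD //.
exists r.
  rewrite -/b -ltr_ln ?posrE ?expR_gt0 // expRK.
  by rewrite mulrC -ltr_pdivrMr.
move=> W /andP[W0 W15].
have X0 : 0 < 1 + k%:R * W by rewrite ltr_pwDl // mulr_ge0.
rewrite -[leLHS]lnK ?posrE ?exprn_gt0 // ler_expR lnXn // -[_ *+ r]mulr_natl.
have hX : ln (1 + k%:R * W) <= 31 * y.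
  have : ln (1 + k%:R * W) <= ln (16 * y ^+ 16).
    rewrite ler_ln ?posrE ?mulr_gt0 ?exprn_gt0 //.
    have : k%:R * W <= y ^+ 16 * 15 by rewrite ler_pM.
    have : 1 <= y ^+ 16 by rewrite exprn_ege1.
    lra.
  have h16 : ln (16 : R) <= 16 - 1 by exact: ln_le_sub1.
  rewrite lnM ?posrE ?exprn_gt0 // lnXn // -mulr_natl; lra.
have hX0 : 0 <= ln (1 + k%:R * W) by apply: ln_ge0; rewrite lerDl mulr_ge0.
apply: le_trans (ler_pM _ _ r_le hX) _ => //.
have -> : C * y ^+ 5 * (31 * y) = 31 * C * y ^+ 6 by ring.
have -> : e * y ^+ 8 = e * y * y * y ^+ 6 by ring.
rewrite ler_pM2r ?exprn_gt0 //.
have h31 : 31 * C <= e * y by rewrite [leRHS]mulrC -ler_pdivrMr.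
apply: le_trans h31 _; rewrite ler_peMr // mulr_ge0 ?ltW //.
Qed.

Lemma expR_le_1D2x h : 0 <= h <= 2^-1 -> expR h <= 1 + 2 * h.
Proof.
move=> /andP[h0 h1]; have h2 := expR_ge1Dx (- h).
have hp := expR_gt0 (- h).
have -> : expR h = (expR (- h))^-1 by rewrite expRN invrK.
rewrite -div1r ler_pdivrMr //; nra.
Qed.

Lemma ln1Dx_ge l : 0 < l -> l / (1 + l) <= ln (1 + l).
Proof.
move=> l0; have l1 : 0 < 1 + l by rewrite addr_gt0.
have : ln (1 + l)^-1 <= (1 + l)^-1 - 1 by apply: ln_le_sub1; rewrite invr_gt0.
rewrite lnV ?posrE //.
have -> : (1 + l)^-1 - 1 = - (l / (1 + l)) by field; rewrite lt0r_neq0.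
lra.
Qed.

(** The tilt multiplies [1 + l] by at most [1 + 2 * h * (l / (1 + l))], and
    [l / (1 + l) <= ln (1 + l)]. *)
Lemma ln_tilt l h : 0 < l -> 0 <= h <= 2^-1 ->
  ln (1 + l * expR h) <= (1 + 2 * h) * ln (1 + l).
Proof.
move=> l0 h01; have /andP[h0 h1] := h01; have l1 : 0 < 1 + l by rewrite addr_gt0.
have E := expR_le_1D2x h01; have Ep := expR_gt0 h.
have h2 : 1 + l * expR h <= (1 + l) * (1 + 2 * h * (l / (1 + l))).
  have -> : (1 + l) * (1 + 2 * h * (l / (1 + l))) = 1 + l * (1 + 2 * h).
    by field; rewrite lt0r_neq0.
  by rewrite lerD2l ler_pM2l.
have q0 : 0 <= 2 * h * (l / (1 + l)) by rewrite !mulr_ge0 ?invr_ge0 ?(ltW l0) ?(ltW l1).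
apply: le_trans (_ : ln ((1 + l) * (1 + 2 * h * (l / (1 + l)))) <= _).
  rewrite ler_ln ?posrE //; first by rewrite addr_gt0 ?mulr_gt0.
  by rewrite mulr_gt0 // ltr_pwDl.
rewrite lnM ?posrE //; last by rewrite ltr_pwDl.
have : ln (1 + 2 * h * (l / (1 + l))) <= 2 * h * (l / (1 + l)).
  by apply: le_ln1Dx; apply: lt_le_trans q0; rewrite ltrN10.
have : 2 * h * (l / (1 + l)) <= 2 * h * ln (1 + l).
  by rewrite ler_wpM2l ?mulr_ge0 // ln1Dx_ge.
lra.
Qed.

(* The fugacity [p / (1 - p)] with [p = x^2 = d / (k / d)] is the one for which the bound
   [l ^- d * (1 + l) ^ (k / d)] on the binomial coefficient of [k / d] and [d] is tight. *)
Lemma entropy_fun_fugacity x : 0 < x < 1 ->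
  entropy_fun x = - (x * ln (x ^+ 2 / (1 - x ^+ 2))) + ln (1 + x ^+ 2 / (1 - x ^+ 2)) / x.
Proof.
move=> x01; have s0 := onem_sqr_gt0 x01; have /andP[x0 _] := x01.
have -> : 1 + x ^+ 2 / (1 - x ^+ 2) = (1 - x ^+ 2)^-1 by field; rewrite lt0r_neq0.
rewrite lnV ?posrE // ln_div ?posrE ?exprn_gt0 // lnXn // /entropy_fun mulr2n.
by field; rewrite lt0r_neq0.
Qed.
End Asymptotics.

(** * The cost of adding one vertex *)

Section StepBound.
Variable R : realType.
Implicit Types (x y e l h mu m c : R) (d k n r : nat).

Lemma ln2_ge_half : 2^-1 <= ln (2 : R).
Proof. by have := @ln1Dx_ge R 1 ltr01; rewrite div1r. Qed.

(** At [e = 0] the left side is [entropy_fun x]; the excess is at most [3 * e * 6], since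
    [x <= 9/10] gives [l <= 6 * x^2]. *)
Lemma entropy_exponent c m e x l : l = x ^+ 2 / (1 - x ^+ 2) -> 0 < x <= 9 / 10 -> 0 < e <= 1 ->
  (forall x, 0 < x < 1 -> entropy_fun x <= c - (x - m) ^+ 2) ->
  - (x * ln l) + (1 + e) ^+ 2 * (ln (1 + l) / x) <= c - (x - m) ^+ 2 + 18 * e.
Proof.
move=> lE /andP[x0 x9] /andP[e0 e1] hmax.
have x01 : 0 < x < 1 by rewrite x0; lra.
have s0 := onem_sqr_gt0 x01.
have hs : 6^-1 <= 1 - x ^+ 2 by rewrite expr2; nra.
have l0 : 0 < l by rewrite lE divr_gt0 // exprn_gt0.
have l6 : l <= 6 * x ^+ 2.
  by rewrite lE ler_pdivrMr // expr2; nra.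
have L : ln (1 + l) / x <= 6.
  rewrite ler_pdivrMr //; apply: le_trans (_ : l <= _).
    by apply: le_ln1Dx; lra.
  by apply: le_trans l6 _; rewrite expr2; nra.
have L0 : 0 <= ln (1 + l) / x by rewrite divr_ge0 ?(ltW x0) // ln_ge0 // lerDl ltW.
have := hmax _ x01; rewrite (entropy_fun_fugacity x01) -lE expr2.
have : ((1 + e) ^+ 2 - 1) * (ln (1 + l) / x) <= 3 * e * 6.
  by apply: ler_pM => //; rewrite expr2; nra.
rewrite !expr2; lra.
Qed.

Lemma sized_sum_container e : 0 < e -> exists2 Y, 1 <= Y &
  forall (T : finType) y n (U : {set T}) (A : {ffun T -> {set T}}) (B d : nat) mu h l,
  Y <= y -> y ^+ 16 = n%:R -> (0 < #|U| <= n)%N -> linear_graph U A ->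
  y ^+ 6 <= d.+1%:R -> 0 < l <= 5 -> 0 <= h <= mu -> h <= 2^-1 ->
  h = 0 \/ ln (1 + l * expR h) <= B.+1%:R / d.+1%:R * ln (1 + l) ->
  sized_sum B mu U A d.+1 <=
    expR (mu * (B - d.+1)%:R - h * d.+1%:R - d.+1%:R * ln l +
          (1 + e) ^+ 2 * #|U|%:R / d.+1%:R * ln (1 + l) + e * y ^+ 8).
Proof.
move=> e0; have [Y Y1 hY] := fingerprint_cost e0; exists Y => //.
move=> T y n U A B d mu h l Yy yn Un hA yd /andP[l0 l5] h0mu h2 hh.
have /andP[h0 _] := h0mu.
(* A new vertex of minimum degree [d.+1] forces all old degrees to be at least [d]; otherwise the
   sum is empty. *)
case: (boolP [forall u in U, (d <= #|A u|)%N]) => [/forall_inP degU|hdeg]; last first.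
  rewrite /sized_sum big1 ?expR_ge0 // => N /andP[/and3P[_ _ /forall_inP hN] /eqP Nd].
  case/negP: hdeg; apply/forall_inP => u uU; have := hN u uU; by rewrite Nd.
have [ed [r hr hW]] := hY y n #|U| d Yy yn Un yd.
apply: le_trans (sized_sum_tilted _ _ _ _ l0 h0mu) _.
set P := mu * _ - _ - _; rewrite -[P + _ + _]addrA (expRD P).
rewrite ler_wpM2l ?expR_ge0 //.
apply: le_trans (indep_sum_tilted hA l0 h0 e0 ed degU hh hr) _.
rewrite expRD ler_wpM2l ?expR_ge0 //; apply: hW.
rewrite mulr_ge0 ?expR_ge0 ?(ltW l0) //=.
have hE : expR h <= 2.
  by apply: le_trans (expR_le_1D2x _) _; [rewrite h0 | lra].
apply: le_trans (_ : 5 * 2 <= _); last by lra.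
by rewrite ler_pM ?(ltW l0) ?expR_ge0.
Qed.

(** Fugacity [1 / n] makes the independent-set sum at most [expR 1] at the price [n^d], whose
    logarithm is at most [16 * y^7]. *)
Lemma sized_sum_small (T : finType) y n (U : {set T}) (A : {ffun T -> {set T}}) (B d : nat) mu e :
  0 <= mu -> 0 < e -> 1 + 17 / e <= y -> y ^+ 16 = n%:R -> (#|U| <= n)%N ->
  d%:R <= y ^+ 6 -> sized_sum B mu U A d <= expR (mu * B%:R + e * y ^+ 8).
Proof.
move=> mu0 e0 hy yn Un dy.
have q0 : 0 < 17 / e by rewrite divr_gt0.
have y1 : 1 <= y by lra.
have y0 : 0 < y by lra.
have n0 : 0 < n%:R :> R by rewrite -yn exprn_gt0.
have ni0 : 0 < n%:R^-1 :> R by rewrite invr_gt0.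
have h0mu : 0 <= (0 : R) <= mu by apply/andP.
apply: le_trans (sized_sum_tilted _ _ _ _ ni0 h0mu) _.
have hP : indep_sum (tilted B A (n%:R^-1 : R) 0) A U <= expR 1.
  have t0 u : 0 <= tilted B A (n%:R^-1 : R) 0 u.
    by apply: tilted_ge0; apply: ltW.
  apply: le_trans (indep_sum_le_prod t0 A U) _.
  apply: le_trans (_ : \prod_(u in U) expR n%:R^-1 <= _).
    apply: ler_prod => u _; rewrite addr_ge0 ?tilted_ge0 ?(ltW ni0) //=.
    apply: le_trans (expR_ge1Dx _); rewrite lerD2l.
    by apply: le_trans (tilted_le _ _ _ (ltW ni0) (lexx 0)) _; rewrite expR0 mulr1.
  rewrite -expR_sum ler_expR sumr_const -[leLHS]mulr_natl ler_pdivrMr // mul1r ler_nat //.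
apply: le_trans (ler_wpM2l (expR_ge0 _) hP) _.
rewrite -expRD ler_expR mul0r subr0 lnV ?posrE // mulrN opprK.
have hB : mu * (B - d)%:R <= mu * B%:R by rewrite ler_wpM2l // ler_nat leq_subr.
have hln : ln n%:R <= 16 * (y - 1).
  rewrite -yn lnXn // -[leLHS]mulr_natl ler_wpM2l //; exact: ln_le_sub1.
have hln0 : 0 <= ln (n%:R : R) by apply: ln_ge0; rewrite -yn exprn_ege1.
have h1 : d%:R * ln n%:R <= y ^+ 6 * (16 * (y - 1)) by exact: ler_pM.
have h2 : 17 <= e * y.
  by rewrite mulrC -ler_pdivrMr //; lra.
have y6 : 1 <= y ^+ 6 by rewrite exprn_ege1.
have h3 : y ^+ 6 * y * 17 <= y ^+ 6 * y * (e * y) by rewrite ler_pM2l ?mulr_gt0 ?exprn_gt0.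
have -> : e * y ^+ 8 = y ^+ 6 * y * (e * y) by ring.
have : 1 <= y ^+ 6 * y by rewrite mulr_ege1.
lra.
Qed.

(* The three regimes of the relative degree [x]: fugacity 1 for [x > 9/10]; the optimal
   fugacity [x^2 / (1 - x^2)] otherwise, with the tilt [h = mu] switched on only when
   [x <= 11/10 * m], where vertices of degree at least [b] are too expensive to matter. *)
Lemma fugacity_choice m c e x s t b bd : 0 < m < 1 -> 0 < e <= 50^-1 ->
  (forall x, 0 < x < 1 -> entropy_fun x <= c - (x - m) ^+ 2) ->
  3 / 2 * ln 2 <= c ->
  0 < x -> 0 < s <= t -> 7 / 6 * m * t <= b + 1 ->
  bd <= b -> (x * s < b + 1 -> bd = b - x * s) ->
  exists l h, [/\ 0 < l <= 5, 0 <= h <= m / 200,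
    h = 0 \/ ln (1 + l * expR h) <= (b + 1) / (x * s) * ln (1 + l) &
    m / 200 * bd - h * (x * s) - x * s * ln l + (1 + e) ^+ 2 * (s / x) * ln (1 + l) + e * t
      <= s * (c - 2 * (m / 200) * m + (m / 200) ^+ 2) + m / 200 * b + 20 * e * t].
Proof.
move=> m01 e01 hmax hc x0 /andP[s0 st] hb bdb hbd.
have /andP[m0 m1] := m01; have /andP[e0 e50] := e01.
set mu := m / 200.
have mu0 : 0 < mu by rewrite divr_gt0.
have mubd : mu * bd <= mu * b by rewrite ler_wpM2l // ltW.
have h0 : 0 <= (0 : R) <= mu by rewrite (ltW mu0) lexx.
have es : e * s <= e * t by rewrite ler_wpM2l // ltW.
have et : 0 <= e * t by rewrite mulr_ge0 ?(ltW e0) // (le_trans (ltW s0)).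
have [x9|x9] := ltP (9 / 10) x.
  exists 1, 0; split=> //; [by apply/andP; split; lra|by left|].
  have m2 : m ^+ 2 <= 1 by rewrite expr_le1 // ltW.
  have mu2 := sqr_ge0 mu.
  have l2 := ln2_ge_half.
  clear hmax hbd bdb hb m01 e01 h0 m1.
  rewrite ln1 mulr0 mul0r !subr0 (_ : 1 + 1 = 2) //.
  have sx : s / x <= 10 / 9 * s.
    by rewrite ler_pdivrMr //; nra.
  have e2 : (1 + e) ^+ 2 <= 21 / 20 by rewrite expr2; nra.
  have h1 : (1 + e) ^+ 2 * (s / x) <= 21 / 20 * (10 / 9 * s).
    by apply: ler_pM; rewrite ?sqr_ge0 // divr_ge0 // ltW.
  have h2 : (1 + e) ^+ 2 * (s / x) * ln 2 <= 21 / 20 * (10 / 9 * s) * ln 2.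
    by rewrite ler_wpM2r // ltW // ln2_gt0.
  have a_ge : c - 100^-1 <= c - 2 * mu * m + mu ^+ 2.
    by clear - m2 mu2; rewrite /mu in mu2 *; rewrite expr2 in m2; lra.
  (* Fugacity 1 costs [7/6 * ln 2] per unit of [s]; the gap to [c >= 3/2 * ln 2] exceeds the loss
     [2 * mu * m <= 1/100]. *)
  have h3 : s * (21 / 20 * (10 / 9) * ln 2) <= s * (c - 2 * mu * m + mu ^+ 2).
    by rewrite ler_wpM2l ?(ltW s0) //; clear - l2 hc a_ge; lra.
  by clear - mubd h2 et h3; lra.
pose l := x ^+ 2 / (1 - x ^+ 2).
have x2 : x ^+ 2 <= 81 / 100 by clear - x0 x9; rewrite expr2; nra.
have x21 : 0 < 1 - x ^+ 2 by clear - x2; lra.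
have l0 : 0 < l by rewrite divr_gt0 ?exprn_gt0.
have l05 : 0 < l <= 5 by rewrite l0 ler_pdivrMr //; clear - x2; lra.
have L0 : 0 < ln (1 + l) by rewrite ln_gt0 // ltrDl.
have hG : - (x * s * ln l) + (1 + e) ^+ 2 * (s / x) * ln (1 + l) <=
    s * (c - (x - m) ^+ 2 + 18 * e).
  have -> : - (x * s * ln l) + (1 + e) ^+ 2 * (s / x) * ln (1 + l) =
      s * (- (x * ln l) + (1 + e) ^+ 2 * (ln (1 + l) / x)).
    by field; exact: lt0r_neq0.
  rewrite ler_wpM2l ?(ltW s0) //; apply: (entropy_exponent erefl _ _ hmax).
    by rewrite x0.
  by rewrite e0 (le_trans e50) // invf_le1 // ler1n.
have [xm|xm] := leP x (11 / 10 * m).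
  have mu01 : 0 <= mu <= 2^-1 by rewrite ltW //= /mu; clear - m1; lra.
  (* The margin [101/100 * 11/10 < 7/6] between [x] and the degree threshold pays for the tilt. *)
  have hq : (1 + 2 * mu) * (x * s) <= b + 1.
    apply: le_trans hb; rewrite mulrA; apply: ler_pM => //.
    - by rewrite mulr_ge0 ?(ltW x0) // addr_ge0 // mulr_ge0 // ltW.
    - exact: ltW.
    - apply: le_trans (_ : 101 / 100 * (11 / 10 * m) <= _); last by clear - m0; lra.
      have mu3 : 1 + 2 * mu <= 101 / 100 by rewrite /mu; clear - m1; lra.
      by apply: ler_pM; rewrite ?(ltW x0) // addr_ge0 // mulr_ge0 // ltW.
  have xs0 : 0 < x * s by rewrite mulr_gt0.
  exists l, mu; split=> //.
  - by rewrite (ltW mu0) lexx.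
  - right; apply: le_trans (ln_tilt l0 mu01) _.
    by rewrite ler_wpM2r ?(ltW L0) // ler_pdivlMr.
  rewrite hbd; last first.
    by apply: lt_le_trans hq; rewrite ltr_pMl // ltrDl mulr_gt0.
  (* The weights contribute [- 2 * mu * x], half from the new vertex and half from its neighbours;
     completing the square bounds this uniformly in [x]. *)
  have h4 : s * (- (x - m) ^+ 2 - 2 * mu * x) <= s * (- (2 * mu * m) + mu ^+ 2).
    rewrite ler_wpM2l ?(ltW s0) //; have := sqr_ge0 (x - m + mu); rewrite !expr2.
    by clear; lra.
  by clear - hG h4 es et; lra.
exists l, 0; split=> //; first by left.
rewrite mul0r subr0.
(* Here the distance from the maximum alone suffices: [(m / 10)^2 = 2 * mu * m], whence
   [mu = m / 200]. *)
have h4 : s * (- (x - m) ^+ 2) <= s * (- (2 * mu * m) + mu ^+ 2).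
  rewrite ler_wpM2l ?(ltW s0) //.
  have : (m / 10) ^+ 2 <= (x - m) ^+ 2.
    have q1 : m / 10 <= x - m by clear - xm; lra.
    have q2 : 0 <= m / 10 by clear - m0; lra.
    by rewrite ler_pXn2r // nnegrE // (le_trans q2).
  have := sqr_ge0 mu; rewrite {2}/mu !expr2; clear; lra.
by clear - hG h4 es et mubd; lra.
Qed.

Lemma step_bound m c e : 0 < m < 1 -> 0 < e <= 50^-1 ->
  (forall x, 0 < x < 1 -> entropy_fun x <= c - (x - m) ^+ 2) ->
  3 / 2 * ln 2 <= c ->
  let mu := m / 200 in
  exists2 Y, 1 <= Y &
  forall (T : finType) y n (U : {set T}) (A : {ffun T -> {set T}}) (B d : nat),
  Y <= y -> y ^+ 16 = n%:R -> (#|U| <= n)%N -> linear_graph U A ->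
  B = Num.trunc (7 / 6 * m * y ^+ 8) ->
  sized_sum B mu U A d <=
    expR (Num.sqrt #|U|%:R * (c - 2 * mu * m + mu ^+ 2) + mu * B%:R + 20 * e * y ^+ 8).
Proof.
move=> m01 e01 hmax hc mu.
have /andP[m0 m1] := m01; have /andP[e0 e50] := e01.
have [Y0 Y01 hY0] := sized_sum_container e0.
have q0 : 0 < 17 / e by rewrite divr_gt0.
exists (Y0 + (1 + 17 / e)); first by clear - Y01 q0; lra.
move=> T y n U A B d Yy yn Un hA BE.
have ye : 1 + 17 / e <= y by clear - Yy Y01; lra.
have Yy0 : Y0 <= y by clear - Yy q0; lra.
have y0 : 0 < y by clear - ye q0; lra.
have mu0 : 0 <= mu by rewrite divr_ge0 // ltW.
have y8 : 0 < y ^+ 8 by rewrite exprn_gt0.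
set k := #|U| in Un *; set s := Num.sqrt k%:R.
have [dy|dy] := leP d%:R (y ^+ 6).
  apply: le_trans (@sized_sum_small T y n U A B d mu e mu0 e0 ye yn Un dy) _.
  have ha : 0 <= s * (c - 2 * mu * m + mu ^+ 2).
    rewrite mulr_ge0 ?sqrtr_ge0 //.
    have l2 := ln2_ge_half; have mu2 := sqr_ge0 mu.
    have m2 : m * m <= 1 by rewrite mulr_ile1 // ltW.
    by clear - l2 mu2 m2 hc; rewrite {1}/mu; lra.
  have ey : 0 <= e * y ^+ 8 by rewrite mulr_ge0 // ltW.
  by rewrite ler_expR; clear - ha ey; lra.
case: d dy => [|d] dy; first by move: dy; rewrite ltNge ltW // exprn_gt0.
have [U0|U0] := posnP k.
  rewrite /sized_sum big1 ?expR_ge0 // => N /andP[/and3P[NU _ _] /eqP Nd].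
  by have := subset_leq_card NU; rewrite Nd -/k U0.
have kR0 : 0 < k%:R :> R by rewrite ltr0n.
have s0 : 0 < s by rewrite sqrtr_gt0.
have sk : s ^+ 2 = k%:R by rewrite sqr_sqrtr // ltW.
have sy : 0 < s <= y ^+ 8.
  rewrite s0 -(ler_pXn2r (_ : 0 < 2)%N) ?nnegrE ?(ltW s0) ?(ltW y8) // sk -exprM.
  by rewrite yn ler_nat.
pose x := d.+1%:R / s.
have dx : x * s = d.+1%:R by rewrite divfK // lt0r_neq0.
have x0 : 0 < x by rewrite divr_gt0.
have kd : (1 + e) ^+ 2 * k%:R / d.+1%:R = (1 + e) ^+ 2 * (s / x).
  by rewrite -mulrA -sk -dx; congr (_ * _); field; rewrite !lt0r_neq0.
have Bt : 7 / 6 * m * y ^+ 8 <= B%:R + 1.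
  by rewrite natr1 BE; apply/ltW; exact: truncnS_gt.
have Bd : (B - d.+1)%:R <= B%:R :> R by rewrite ler_nat leq_subr.
have Bd' : x * s < B%:R + 1 -> (B - d.+1)%:R = B%:R - x * s.
  by rewrite dx natr1 ltr_nat ltnS => ?; rewrite natrB.
have [l [h [l05 h0 hh hE]]] := fugacity_choice m01 e01 hmax hc x0 sy Bt Bd Bd'.
rewrite dx natr1 in hh hE.
have Un' : (0 < k <= n)%N by rewrite U0.
have h2 : h <= 2^-1 by case/andP: h0 => _ hm; clear - hm m1; lra.
apply: le_trans (hY0 T y n U A B d mu h l Yy0 yn Un' hA (ltW dy) l05 h0 h2 hh) _.
by rewrite ler_expR -/k kd.
Qed.
End StepBound.

(** * The upper bound *)

Section GraphCount.
Variable R : realType.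

Lemma sum_sqrt_le n : \sum_(k < n) Num.sqrt k%:R <= 2 / 3 * Num.sqrt n%:R ^+ 3 :> R.
Proof.
elim: n => [|n IHn]; first by rewrite big_ord0 mulr_ge0 // exprn_ge0 // sqrtr_ge0.
rewrite big_ord_recr /=; apply: le_trans (lerD IHn (lexx _)) _.
have a0 : 0 <= Num.sqrt (n%:R : R) by exact: sqrtr_ge0.
have b0 : 0 <= Num.sqrt (n.+1%:R : R) by exact: sqrtr_ge0.
have ab : Num.sqrt n%:R <= Num.sqrt n.+1%:R :> R by rewrite ler_wsqrtr // ler_nat.
have b2 : Num.sqrt n.+1%:R ^+ 2 = Num.sqrt n%:R ^+ 2 + 1 :> R.
  by rewrite !sqr_sqrtr // natr1.
set a := Num.sqrt n%:R in a0 ab b2 *; set b := Num.sqrt n.+1%:R in b0 ab b2 *.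
(* With [b^2 - a^2 = 1] this says that [2/3 * t^3] grows by at least [a] between [a] and [b]. *)
have h : a * 3 * (b ^+ 2 - a ^+ 2) <= 2 * (b ^+ 3 - a ^+ 3).
  rewrite -subr_ge0.
  have -> : 2 * (b ^+ 3 - a ^+ 3) - a * 3 * (b ^+ 2 - a ^+ 2) = (b - a) ^+ 2 * (2 * b + a) by ring.
  by rewrite mulr_ge0 ?sqr_ge0 // addr_ge0 // mulr_ge0.
have e1 : b ^+ 2 - a ^+ 2 = 1 by rewrite b2 addrAC subrr add0r.
rewrite e1 in h; lra.
Qed.

Lemma num_C4_free_gt0 n : (0 < num_C4_free n)%N.
Proof.
apply/card_gt0P; exists finset.set0; rewrite inE; apply/andP; split.
  by apply/forall_inP => e; rewrite inE.
apply/existsP => -[[[|x [|z s]] // sz] /andP[/=]].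
  by rewrite /adj inE.
Qed.

Lemma num_C4_free_bound (n B : nat) (y a mu s : R) : 0 <= a -> 0 <= mu ->
  y ^+ 16 = n%:R -> 1 <= y ->
  (forall (T : finType) (U : {set T}) (A : {ffun T -> {set T}}) (d : nat),
    (#|U| <= n)%N -> linear_graph U A ->
    sized_sum B mu U A d <= expR (Num.sqrt #|U|%:R * a + s)) ->
  ln (num_C4_free n)%:R <= n%:R * (32 * y + 2 / 3 * a * y ^+ 8 + s).
Proof.
move=> a0 mu0 yn y1 hstep.
have y0 : 0 < y by lra.
pose b (k : nat) := n.+1%:R * expR (Num.sqrt k%:R * a + s).
have b0 k : 0 <= b k by rewrite mulr_ge0 ?expR_ge0.
have F0 : 0 < (num_C4_free n)%:R :> R by rewrite ltr0n num_C4_free_gt0.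
have hF : (num_C4_free n)%:R <= \prod_(k < n) (k.+1%:R * b k).
  apply: le_trans (num_C4_free_le n B mu0) _.
  have := @partition_fun_le_prod R 'I_n mu B [set: 'I_n]%SET b b0.
  rewrite cardsT card_ord; apply => V A hV hA.
  by apply: extension_sum_sized (ltnW hV) _ => d; apply: hstep => //; apply: ltnW.
have hn : ln (n.+1%:R : R) <= 16 * y.
  have : ln (n.+1%:R : R) <= ln (2 * y ^+ 16).
    rewrite ler_ln ?posrE ?mulr_gt0 ?exprn_gt0 //.
    by have := exprn_ege1 16 y1; rewrite yn -natr1; lra.
  rewrite lnM ?posrE ?exprn_gt0 // lnXn // -[ln y *+ 16]mulr_natl.
  have := ln_le_sub1 y0; have := @ln_le_sub1 R 2; lra.
(* Two factors of at most [n.+1 <= expR (16 * y)]: the choice of the removed vertex and the size of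
   its neighbourhood. *)
have hterm (k : 'I_n) : k.+1%:R * b k <= expR (32 * y + (Num.sqrt k%:R * a + s)).
  rewrite /b (expRD (32 * y)) mulrA ler_wpM2r ?expR_ge0 //.
  apply: le_trans (_ : n.+1%:R * n.+1%:R <= _).
    by rewrite ler_wpM2r // ler_nat ltnS ltnW.
  rewrite -[n.+1%:R]lnK ?posrE // -expRD ler_expR; lra.
have : ln (num_C4_free n)%:R <= \sum_(k < n) (32 * y + (Num.sqrt k%:R * a + s)).
  rewrite -ler_expR lnK ?posrE // expR_sum; apply: le_trans hF _.
  by apply: ler_prod => k _; rewrite hterm mulr_ge0.
move=> h; apply: le_trans h _.
rewrite !big_split /= !sumr_const card_ord -mulr_suml -[32 * y *+ n]mulr_natl -[s *+ n]mulr_natl.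
have hs := sum_sqrt_le n.
have sn : Num.sqrt n%:R = y ^+ 8.
  by rewrite -yn (exprM y 8 2) sqrtr_sqr ger0_norm // exprn_ge0 // ltW.
rewrite sn in hs.
have := ler_wpM2r a0 hs.
have -> : 2 / 3 * (y ^+ 8) ^+ 3 * a = n%:R * (2 / 3 * a * y ^+ 8) by rewrite -yn; ring.
lra.
Qed.
End GraphCount.

Unset Implicit Arguments.

Local Open Scope classical_set_scope.

Theorem theorem5p2 (R : realType) :
  exists2 delta : R, 0 < delta &
  exists2 eps : nat -> R, eps n @[n --> \oo] --> (0 : R) &
  \forall n \near \oo,
    log2 (num_C4_free n)%:R
      <= (1 + eps n) * (gamma R - delta) * n%:R `^ (3 / 2).
Proof.
have [m m01 hmax] := entropy_fun_strict_max R.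
have hc := gamma_ln2_ge R.
have /andP[m0 m1] := m01.
have ln2 := ln2_gt0 R.
have m2 : 0 < m ^+ 2 by rewrite exprn_gt0.
have m21 : m ^+ 2 <= 1 by rewrite expr_le1 // ltW.
pose e := m ^+ 2 / 20 / 100 / 100.
have e01 : 0 < e <= 50^-1 by rewrite /e; apply/andP; split; lra.
have [Y Y1 hY] := step_bound m01 e01 hmax hc.
exists (m ^+ 2 / 20 / 100 / ln 2); first by rewrite !divr_gt0.
(* The saving exceeds [delta] by enough to absorb all lower-order terms. *)
exists (fun=> 0); first exact: cvg_cst.
pose Z := Y + 32 / (20 * e).
have e0 : 0 < e by case/andP: e01.
have z0 : 0 < 32 / (20 * e) by rewrite divr_gt0 // mulr_gt0.
exists (Num.trunc (Z ^+ 16)).+1 => // n /= hn.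
have Zn : Z ^+ 16 <= n%:R.
  by apply/ltW; apply: lt_le_trans (truncnS_gt _) _; rewrite ler_nat.
pose y : R := Num.sqrt (Num.sqrt (Num.sqrt (Num.sqrt n%:R))).
have yn : y ^+ 16 = n%:R.
  by rewrite (exprM y 8 2) (exprM y 4 2) (exprM y 2 2) !sqr_sqrtr ?sqrtr_ge0.
have y_ge0 : 0 <= y by exact: sqrtr_ge0.
have Z0 : 0 <= Z by rewrite /Z; lra.
have Zy : Z <= y by rewrite -(ler_pXn2r (_ : 0 < 16)%N) ?nnegrE // yn.
have Yy : Y <= y by rewrite /Z in Zy; lra.
have y1 : 1 <= y by lra.
have ye : 32 <= 20 * e * y.
  by rewrite mulrC -ler_pdivrMr ?mulr_gt0 //; rewrite /Z in Zy; lra.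
set c := 3 / 2 * gamma R * ln 2 in hmax hc hY.
set mu := m / 200 in hY; pose B := Num.trunc (7 / 6 * m * y ^+ 8).
have mu0 : 0 <= mu by rewrite divr_ge0 // ltW.
set a := c - 2 * mu * m + mu ^+ 2 in hY.
have ln2' := ln2_ge_half R.
have a0 : 0 <= a.
  have mu2 := sqr_ge0 mu; rewrite /a; rewrite expr2 in m21.
  by clear - hc ln2' mu2 m21; rewrite /mu in mu2 *; lra.
have y8 : 0 < y ^+ 8 by rewrite exprn_gt0 //; lra.
have hF := @num_C4_free_bound R n B y a mu (mu * B%:R + 20 * e * y ^+ 8) a0 mu0 yn y1.
have {hF} : ln (num_C4_free n)%:R <=
    n%:R * (32 * y + 2 / 3 * a * y ^+ 8 + (mu * B%:R + 20 * e * y ^+ 8)).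
  apply: hF => T U A d Un hA; rewrite addrA; exact: (hY T y n U A B d).
move=> hF.
have hB : mu * B%:R <= mu * (7 / 6 * m * y ^+ 8).
  by rewrite ler_wpM2l // truncn_le !mulr_ge0 // ltW.
have h32 : 32 * y <= 20 * e * y ^+ 8.
  have : 1 <= y ^+ 6 by rewrite exprn_ege1.
  have : 32 * y <= 20 * e * y * y by rewrite ler_wpM2r.
  move=> h1 h2; apply: le_trans h1 _.
  have -> : 20 * e * y ^+ 8 = 20 * e * y * y * y ^+ 6 by ring.
  by rewrite ler_peMr // !mulr_ge0 // ltW.
have pow : n%:R `^ (3 / 2) = n%:R * y ^+ 8.
  rewrite -yn -powR_mulrn // -powRrM (_ : 16%:R * (3 / 2) = 24%:R); last by field.
  by rewrite powR_mulrn // powR_mulrn // -exprD.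
rewrite addr0 mul1r pow /log2 ler_pdivrMr //.
apply: le_trans hF _.
have -> : (gamma R - m ^+ 2 / 20 / 100 / ln 2) * (n%:R * y ^+ 8) * ln 2 =
    n%:R * ((2 / 3 * c - m ^+ 2 / 20 / 100) * y ^+ 8).
  by rewrite /c; field; apply: lt0r_neq0.
rewrite ler_wpM2l //.
(* The saving [(4/3 - 7/6) * mu * m = m^2 / 1200] exceeds the errors [2/3 * mu^2 = m^2 / 60000] and
   [40 * e = m^2 / 5000] by more than [m^2 / 2000]. *)
have : (2 / 3 * a + mu * (7 / 6 * m) + 40 * e) * y ^+ 8 <= (2 / 3 * c - m ^+ 2 / 20 / 100) * y ^+ 8.
  by rewrite ler_wpM2r ?(ltW y8) // /a /mu /e !expr2; rewrite expr2 in m2; lra.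
lra.
Qed.
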